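(* Let $G$ be a connected real Lie group with identity $e$ and Lie algebra $\mathfrak{g}$ of right invariant vector fields. Let $\mathcal{X}_0=\mathcal{X},\mathcal{X}_1,\ldots,\mathcal{X}_m$ be linear vector fields on $G$ with $[\mathcal{X}_i,\mathcal{X}_j]=0$ for all $i,j$, whose associated derivations are inner, and let $X_0=X,X_1,\ldots,X_m\in\mathfrak{g}$ satisfy $\mathcal{X}_i=X_i+dI X_i$ and $[X_i,X_j]=0$ for all $i,j=0,\ldots,m$. Let $Y,Y_1,\ldots,Y_m\in\mathfrak{g}$ and consider the affine system $$\Sigma_A:\ \frac{dg}{dt}=(\mathcal{X}+Y)(g)+\sum_{j=1}^{m}u_j(\mathcal{X}_j+Y_j)(g)$$ and the right invariant system $$\Sigma_I:\ \frac{dg}{dt}=(X+Y)(g)+\sum_{j=1}^{m}u_j(X_j+Y_j)(g).$$ Assume that the admissible controls are the piecewise constant functions with values in $U\subset\mathbb{R}^m$, and that $\Sigma_I$ is controllable. If $e\in\operatorname{int}(\mathcal{A}_t)$ for some $t>0$, then $\Sigma_A$ is controllable.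
   Context: A vector field on $G$ is called linear if its flow is a one-parameter group of automorphisms of $G$. A linear vector field $\mathcal{X}_i$ has associated derivation $\mathcal{D}_i(Z)=-[\mathcal{X}_i,Z]$ of $\mathfrak{g}$. Let $I(g)=g^{-1}$; $dI X_i$ denotes the left invariant vector field $I_*X_i$ induced by $X_i$. The relation $\mathcal{X}_i=X_i+dI X_i$ is equivalent to the flow of $\mathcal{X}_i$ being $g\mapsto\exp(tX_i)\,g\,\exp(-tX_i)$. For a control system, the reachable set from $g$ at time $t>0$ is the set of endpoints at time $t$ of solutions starting at $g$ under admissible controls; $\mathcal{A}_t=\mathcal{A}_t(e)$ denotes the reachable set of $\Sigma_A$ from $e$ at time $t$. The reachable set from $g$ is the union over $t>0$ of the reachable sets at time $t$. A system is controllable if the reachable set from every point of $G$ is all of $G$. *)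

(* Defs.v *)
From HB Require Import structures.
From mathcomp Require Import all_boot all_order all_algebra.
From mathcomp Require Import all_classical all_reals all_analysis.

Set Implicit Arguments.
Unset Strict Implicit.
Unset Printing Implicit Defensive.

Import Order.TTheory GRing.Theory Num.Theory.
Import numFieldNormedType.Exports.

Local Open Scope classical_set_scope.
Local Open Scope ring_scope.

(* On an open set [U] of a finite-dimensional space, [f] is C^(k+1) iff it is
   differentiable and all its directional derivatives are C^k. These predicates
   are only used for open [U]. *)
Fixpoint Ck_on (R : realType) (V W : normedModType R) (k : nat) (U : set V)
    (f : V -> W) : Prop :=
  if k is k'.+1 then
    (forall x, U x -> differentiable f x) /\
    (forall v, Ck_on k' U (fun x => 'D_v f x))
  else forall x, U x -> {for x, continuous f}.

Definition smooth_on (R : realType) (V W : normedModType R) (U : set V)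
    (f : V -> W) : Prop :=
  forall k, Ck_on k U f.

(* The maps are total; only their values on [chart_dom], resp. on its image,
   are meaningful. *)
Record chart (R : realType) (n : nat) (M : topologicalType) := Chart {
  chart_dom : set M ;
  chart_fun :> M -> 'rV[R]_n ;
  chart_inv : 'rV[R]_n -> M ;
  open_chart_dom : open chart_dom ;
  open_chart_im : open (chart_fun @` chart_dom) ;
  chart_funK : forall x, chart_dom x -> chart_inv (chart_fun x) = x ;
  chart_fun_continuous : forall x, chart_dom x -> {for x, continuous chart_fun} ;
  chart_inv_continuous : forall y, (chart_fun @` chart_dom) y ->
    {for y, continuous chart_inv}
}.

HB.mixin Record isManifold (R : realType) (n : nat) M of Topological M := {
  manifold_hausdorff : hausdorff_space M ;
  manifold_second_countable : @second_countable M ;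
  atlas : set (chart R n M) ;
  atlas_cover : forall x : M, exists2 c, atlas c & chart_dom c x ;
  atlas_compatible : forall c c', atlas c -> atlas c' ->
    smooth_on (c @` (chart_dom c `&` chart_dom c')) (c' \o chart_inv c)
}.

#[short(type="manifoldType")]
HB.structure Definition Manifold (R : realType) (n : nat) :=
  {M of isManifold R n M & Topological M}.

Definition smooth_fun (R : realType) (n : nat) (M : manifoldType R n)
    (f : M -> R) : Prop :=
  forall c : chart R n M, atlas c ->
    smooth_on (c @` chart_dom c) (f \o chart_inv c : 'rV[R]_n -> R).

Definition smooth_map (R : realType) (n p : nat) (M : manifoldType R n)
    (N : manifoldType R p) (F : M -> N) : Prop :=
  continuous F /\
  forall (c : chart R n M) (d : chart R p N), atlas c -> atlas d ->
    smooth_on (c @` (chart_dom c `&` F @^-1` chart_dom d))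
              (d \o F \o chart_inv c).

(* Smoothness on the product manifold [M1 * M2], read in product charts. *)
Definition smooth_map2 (R : realType) (n1 n2 p : nat) (M1 : manifoldType R n1)
    (M2 : manifoldType R n2) (N : manifoldType R p) (F : M1 * M2 -> N) : Prop :=
  continuous F /\
  forall (c1 : chart R n1 M1) (c2 : chart R n2 M2) (d : chart R p N),
    atlas c1 -> atlas c2 -> atlas d ->
    smooth_on
      [set y : 'rV[R]_n1 * 'rV[R]_n2 |
         [/\ (c1 @` chart_dom c1) y.1, (c2 @` chart_dom c2) y.2 &
             chart_dom d (F (chart_inv c1 y.1, chart_inv c2 y.2))]]
      (fun y : 'rV[R]_n1 * 'rV[R]_n2 =>
         d (F (chart_inv c1 y.1, chart_inv c2 y.2))).

HB.mixin Record isLieGroup (R : realType) (n : nat) G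
    of Manifold R n G & Group G := {
  mulg_smooth : smooth_map2 (fun x : G * G => (x.1 * x.2)%g) ;
  invg_smooth : smooth_map (fun x : G => x^-1%g)
}.

#[short(type="lieGroupType")]
HB.structure Definition LieGroup (R : realType) (n : nat) :=
  {G of isLieGroup R n G & Manifold R n G & Group G}.

(* Vector fields are derivations of the algebra of smooth functions, [X f x]
   being the derivative of [f] at [x] along [X x]. A term of type [vfield M] is
   meaningful on smooth functions only, hence the equality [vf_eq]. *)
Definition vfield (R : realType) (n : nat) (M : manifoldType R n) : Type :=
  (M -> R) -> M -> R.

Section VectorFields.
Context (R : realType) (n : nat) (M : manifoldType R n).
Implicit Types X Y : vfield M.

Record is_vfield X : Prop := IsVfield {
  vf_smooth : forall f, smooth_fun f -> smooth_fun (X f) ;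
  vf_linear : forall (a : R) f g, smooth_fun f -> smooth_fun g ->
    forall x, X (fun y => a * f y + g y) x = a * X f x + X g x ;
  vf_leibniz : forall f g, smooth_fun f -> smooth_fun g ->
    forall x, X (fun y => f y * g y) x = X f x * g x + f x * X g x
}.

Definition vf_eq X Y : Prop :=
  forall f, smooth_fun f -> forall x, X f x = Y f x.

Definition vf0 : vfield M := fun _ _ => 0.
Definition vf_add X Y : vfield M := fun f x => X f x + Y f x.
Definition vf_opp X : vfield M := fun f x => - X f x.
Definition vf_bracket X Y : vfield M := fun f x => X (Y f) x - Y (X f) x.

Definition is_flow X (phi : R -> M -> M) : Prop :=
  (forall x, phi 0 x = x) /\
  forall x t f, smooth_fun f ->
    is_derive t (1 : R) (fun s => f (phi s x)) (X f (phi t x)).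

(* [F0 + \sum_j u_j F_j] *)
Definition control_affine (m : nat) (F0 : vfield M) (F : 'I_m -> vfield M)
    (u : 'rV[R]_m) : vfield M :=
  fun f x => F0 f x + \sum_(j < m) u ord0 j * F j f x.

(* [u] is constant inside each interval of some subdivision
   [0 < s_0 < ... < s_k = t]; its values at the nodes are irrelevant to the
   trajectories. *)
Definition admissible (m : nat) (U : set 'rV[R]_m) (t : R)
    (u : R -> 'rV[R]_m) : Prop :=
  (forall s, s \in `[0, t] -> U (u s)) /\
  exists2 sub : seq R, itv_partition 0 t sub &
    forall i, (i < size sub)%N ->
      {in `]nth 0 (0 :: sub) i, nth 0 sub i[ &, forall s s', u s = u s'}.

(* The differential equation holds away from finitely many times. *)
Definition trajectory (m : nat) (F : 'rV[R]_m -> vfield M) (t : R)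
    (u : R -> 'rV[R]_m) (gamma : R -> M) : Prop :=
  {within `[0, t], continuous gamma} /\
  exists2 S : set R, finite_set S &
    forall s, s \in `]0, t[ -> ~ S s -> forall f, smooth_fun f ->
      is_derive s (1 : R) (fun r => f (gamma r)) (F (u s) f (gamma s)).

Definition reachable_at (m : nat) (F : 'rV[R]_m -> vfield M)
    (U : set 'rV[R]_m) (g : M) (t : R) : set M :=
  [set h | exists u gamma, [/\ admissible U t u, trajectory F t u gamma,
                               gamma 0 = g & gamma t = h]].

Definition reachable (m : nat) (F : 'rV[R]_m -> vfield M)
    (U : set 'rV[R]_m) (g : M) : set M :=
  \bigcup_(t in [set t : R | 0 < t]) reachable_at F U g t.

Definition controllable (m : nat) (F : 'rV[R]_m -> vfield M)
    (U : set 'rV[R]_m) : Prop :=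
  forall g, reachable F U g = setT.

End VectorFields.

Section InvariantFields.
Context (R : realType) (n : nat) (G : lieGroupType R n).
Implicit Types X Z : vfield G.

(* Membership in the Lie algebra [g]: [X] is preserved by all right
   translations [x |-> x * h]. *)
Definition right_invariant X : Prop :=
  is_vfield X /\
  forall (h : G) f, smooth_fun f ->
    forall x, X (fun y => f (y * h)%g) x = X f (x * h)%g.

(* Pushforward [I_* X] by [I : g |-> g^-1]. *)
Definition dI X : vfield G := fun f x => X (fun y => f (y^-1)%g) (x^-1)%g.

Definition lie_automorphism (phi : G -> G) : Prop :=
  [/\ {morph phi : x y / (x * y)%g >-> (x * y)%g},
      smooth_map phi &
      exists psi : G -> G,
        [/\ cancel phi psi, cancel psi phi & smooth_map psi]].

Definition linear_field X : Prop :=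
  is_vfield X /\
  exists phi : R -> G -> G,
    [/\ is_flow X phi,
        (forall s t x, phi (s + t) x = phi s (phi t x)) &
        forall t, lie_automorphism (phi t)].

(* The derivation [Z |-> - [X, Z]] of the Lie algebra associated with a linear
   field. *)
Definition assoc_derivation X : vfield G -> vfield G :=
  fun Z => vf_opp (vf_bracket X Z).

Definition inner_derivation (D : vfield G -> vfield G) : Prop :=
  exists2 W, right_invariant W &
    forall Z, right_invariant Z -> vf_eq (D Z) (vf_bracket W Z).

End InvariantFields.

(* Main.v *)
From HB Require Import structures.
Require Import Defs.
From mathcomp Require Import all_boot all_order all_algebra.
From mathcomp Require Import all_classical all_reals all_analysis.
From mathcomp Require Import ring lra.

Set Implicit Arguments.
Unset Strict Implicit.
Unset Printing Implicit Defensive.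

Import Order.TTheory GRing.Theory Num.Theory.
Import numFieldNormedType.Exports.

Local Open Scope classical_set_scope.
Local Open Scope ring_scope.

(** Write Sigma_I(u) = P_u and let W_u be the sum of X_0 and of the u_j X_j. The
right invariant fields P_u and W_u satisfy Sigma_A(u) = P_u + dI W_u, and dI W_u
is left invariant. Solutions of the affine system are therefore products: if
gamma is a trajectory of Sigma_I with control u, and v solves v' = dI W_u (v)
with v(0) = 1, then gamma(r) k v(r) is, for every constant k, a trajectory of
Sigma_A with the same control ([trajectory_compensated]).

The compensating curve v stays in the group Cen of the elements z whose left
translation preserves all the W_u ([curve_of_left_invariant]); this is where
[X_i, X_j] = 0 enters, together with dI X_i = - X_i at 1, which holds because
the flow of the linear field X_i + dI X_i consists of automorphisms and so
fixes 1. Right translation by an element of Cen maps trajectories of Sigma_A to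
trajectories of Sigma_A, the summand P_u being invariant under every right
translation ([reachable_rmul]). Hence the elements of Cen reachable from 1
form a semigroup. It contains all the elements of Cen near 1, as 1 is interior
to a reachable set; moving along the path v by small steps one finds that
every v(r)^-1 is reachable from 1 ([compensator_reachable]).

To steer g to h, take a trajectory of Sigma_I from g to 1 with compensator v, and
one from 1 to h with compensator v'; let a and b be the endpoints of v and v'.
The first one gives a trajectory of Sigma_A from g to a; since a^-1 is reachable
from 1, right translation by a steers a to 1; then b^-1 is reachable from 1;
and the second trajectory, with k = b^-1, goes from b^-1 to h.

Vector fields being derivations, the differential calculus behind this rests on
their expression in charts ([vf_local_expr]), which comes from Hadamard's lemma
and the extension of locally defined smooth functions by bump functions. From
it follow that fields acting on separate variables commute ([vf_swap], through
the symmetry of second derivatives) and that integral curves exist for a short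
time ([curve_of_exists], by Picard iteration). *)

(** * Functions of class C^k *)

Section Ck.
Context {R : realType}.
Implicit Types (V W : normedModType R) (k : nat).

Lemma differentiable_near V W (f g : V -> W) x :
  (\forall y \near x, f y = g y) -> differentiable f x -> differentiable g x.
Proof.
move=> fg /diff_locallyP[cf Hf].
have fgx : f x = g x by exact: nbhs_singleton fg.
suff Hg : g \o shift x = cst (g x) + 'd f x +o_ 0 id.
  by apply/diff_locallyP; rewrite (diff_unique cf Hg).
apply/eqaddoP => e e0.
move/eqaddoP: Hf => /(_ e e0) Hf.
have fg0 : \forall h \near (0 : V), f (h + x) = g (h + x).
  by move/nbhs0P: fg; apply: filterS => h; rewrite addrC.
near=> h.
have E : (g \o shift x - (cst (g x) + 'd f x)) h =
   (f \o shift x - (cst (f x) + 'd f x)) h.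
  by rewrite !fctE /= -fgx; congr (_ - _); symmetry; near: h.
by rewrite E; near: h.
Unshelve. all: by end_near. Qed.

Lemma Ck_on_eq V W k (U : set V) (f g : V -> W) : open U ->
  (forall x, U x -> f x = g x) -> Ck_on k U f -> Ck_on k U g.
Proof.
move=> oU; elim: k f g => [|k IH] f g fg /=.
  move=> cf x Ux; have fgx : \forall y \near x, f y = g y.
    by apply: filterS (open_nbhs_nbhs (conj oU Ux)) => y /fg.
  rewrite /prop_for /continuous_at -(fg x Ux); apply: cvg_trans (cf x Ux).
  by apply: near_eq_cvg; apply: filterS fgx => y ->.
case=> df Df; split.
  move=> x Ux; apply: differentiable_near (df x Ux).
  by apply: filterS (open_nbhs_nbhs (conj oU Ux)) => y /fg.
move=> v; apply: IH (Df v) => x Ux; apply: near_eq_derive.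
by apply: filterS (open_nbhs_nbhs (conj oU Ux)) => y /fg.
Qed.

Lemma Ck_onS V W k (U : set V) (f : V -> W) : Ck_on k.+1 U f -> Ck_on k U f.
Proof.
elim: k f => [|k IH] f [df Df] /=.
  by move=> x /df; exact: differentiable_continuous.
by split=> // v; apply: IH; exact: Df.
Qed.

(** The predicate refers to [U] only through its points, so that [B] may be any
set containing the point considered. *)
Lemma Ck_on_local V W k (U : set V) (f : V -> W) :
  (forall x, U x -> exists2 B : set V, B x & Ck_on k B f) -> Ck_on k U f.
Proof.
elim: k f => [|k IH] f H /=; first by move=> x /H[B Bx] /(_ x Bx).
split; first by move=> x /H[B Bx [/(_ x Bx)]].
by move=> v; apply: IH => x /H[B Bx [_ Df]]; exists B => //; exact: Df.
Qed.

Lemma Ck_onW V W k (U O : set V) (f : V -> W) : U `<=` O ->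
  Ck_on k O f -> Ck_on k U f.
Proof. by move=> UO H; apply: Ck_on_local => x /UO Ox; exists O. Qed.

Lemma Ck_on_cst V W k (U : set V) (w : W) : Ck_on k U (fun _ : V => w).
Proof.
elim: k w => [|k IH] w /=; first by move=> x _; exact: cvg_cst.
split; first by move=> x _; exact: differentiable_cst.
move=> v; rewrite (_ : 'D_v (fun=> w) = fun=> 0) //.
by apply/funext => x; rewrite derive_cst.
Qed.

Lemma Ck_onD V W k (U : set V) (f g : V -> W) : open U ->
  Ck_on k U f -> Ck_on k U g -> Ck_on k U (fun x => f x + g x).
Proof.
move=> oU; elim: k f g => [|k IH] f g /=.
  by move=> cf cg x Ux; apply: cvgD; [exact: cf|exact: cg].
move=> [df Df] [dg Dg]; split.
  by move=> x Ux; apply: (@differentiableD _ _ _ f g); [exact: df|exact: dg].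
move=> v; apply: Ck_on_eq (IH _ _ (Df v) (Dg v)) => // x Ux.
by rewrite (@deriveD _ _ _ f g) //; apply: diff_derivable; [exact: df|exact: dg].
Qed.

Lemma Ck_onM V k (U : set V) (f g : V -> R) : open U ->
  Ck_on k U f -> Ck_on k U g -> Ck_on k U (fun x => f x * g x).
Proof.
move=> oU; elim: k f g => [|k IH] f g.
  by move=> cf cg x Ux; apply: cvgM; [exact: cf|exact: cg].
move=> Hf Hg; have Hf' := Ck_onS Hf; have Hg' := Ck_onS Hg.
case: Hf => df Df; case: Hg => dg Dg; split.
  by move=> x Ux; apply: (@differentiableM _ _ f g); [exact: df|exact: dg].
move=> v.
apply: Ck_on_eq (Ck_onD oU (IH _ _ Hf' (Dg v)) (IH _ _ Hg' (Df v))) => // x Ux.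
by rewrite (@deriveM _ _ f g) //; apply: diff_derivable; [exact: df|exact: dg].
Qed.

Lemma Ck_on_sum V W k (U : set V) (I : Type) (r : seq I) (f : I -> V -> W) :
  open U -> (forall i, Ck_on k U (f i)) -> Ck_on k U (fun x => \sum_(i <- r) f i x).
Proof.
move=> oU Hf; elim: r => [|i r IH].
  by apply: (Ck_on_eq oU _ (@Ck_on_cst _ _ _ _ 0)) => x _; rewrite big_nil.
by apply: (Ck_on_eq oU _ (Ck_onD oU (Hf i) IH)) => x _; rewrite big_cons.
Qed.

Lemma is_diff_linear V W (l : V -> W) x : linear l -> continuous l ->
  is_diff x l l.
Proof.
move=> ll cl.
pose L : {linear V -> W} := HB.pack l (GRing.isLinear.Build _ _ _ _ l ll).
have cL : continuous L by [].
by apply: DiffDef; [exact: (linear_differentiable x cL)|exact: (diff_lin x cL)].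
Qed.

Lemma derive_linear V W (l : V -> W) x v : linear l -> continuous l ->
  'D_v l x = l v.
Proof.
move=> ll cl; have dl := is_diff_linear x ll cl.
by rewrite deriveE // diff_val.
Qed.

Lemma Ck_on_linear V W k (U : set V) (l : V -> W) : linear l ->
  continuous l -> Ck_on k U l.
Proof.
move=> ll cl; case: k => [|k] /=; first by move=> x _; exact: cl.
split; first by move=> x _; have dl := is_diff_linear x ll cl; exact: ex_diff.
move=> v; rewrite (_ : 'D_v l = fun=> l v); first exact: Ck_on_cst.
by apply/funext => x; exact: derive_linear.
Qed.

Lemma derive_comp_linear V W W' (l : W -> W') (f : V -> W) x v : linear l ->
  continuous l -> differentiable f x -> 'D_v (l \o f) x = l ('D_v f x).
Proof.
move=> ll cl df; have dl := is_diff_linear (f x) ll cl.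
rewrite deriveE; last exact: differentiable_comp.
by rewrite diff_comp // diff_val /= deriveE.
Qed.

Lemma Ck_on_linear_comp V W W' k (U : set V) (l : W -> W') (f : V -> W) :
  open U -> linear l -> continuous l -> Ck_on k U f -> Ck_on k U (l \o f).
Proof.
move=> oU ll cl; elim: k f => [|k IH] f /=.
  by move=> cf x Ux; apply: continuous_comp; [exact: cf|exact: cl].
move=> [df Df]; split.
  move=> x Ux; have dl := is_diff_linear (f x) ll cl.
  by apply: differentiable_comp => //; exact: df.
move=> v; apply: Ck_on_eq (IH _ (Df v)) => // x Ux.
by rewrite derive_comp_linear //; exact: df.
Qed.

(** A finite basis with continuous coordinate forms. This is the form of finite
dimensionality that passes to products and makes the chain rule a finite
sum. *)
Definition has_coords W := exists (N : nat) (e : 'I_N -> W) (l : 'I_N -> W -> R),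
  (forall i, linear (l i) /\ continuous (l i)) /\
  forall w, w = \sum_i l i w *: e i.

Lemma derive_comp_coords V W W' N (e : 'I_N -> W) (l : 'I_N -> W -> R)
    (f : V -> W) (g : W -> W') x v :
  (forall w, w = \sum_i l i w *: e i) ->
  differentiable f x -> differentiable g (f x) ->
  'D_v (g \o f) x = \sum_i l i ('D_v f x) *: 'D_(e i) g (f x).
Proof.
move=> lE df dg; rewrite deriveE; last exact: differentiable_comp.
rewrite diff_comp //= -(deriveE v df) {1}[derive f x v]lE linear_sum.
by apply: eq_bigr => i _; rewrite linearZ /= (deriveE _ dg).
Qed.

(** The derivatives of [g \o f] are sums of products of coordinates of 'D_v f
with functions ('D_e g) \o f, to which the induction hypothesis applies. *)
Lemma Ck_on_comp V W k (U : set V) (O : set W) (f : V -> W) (g : W -> R) :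
  has_coords W -> open U -> (forall x, U x -> O (f x)) ->
  Ck_on k U f -> Ck_on k O g -> Ck_on k U (g \o f).
Proof.
move=> [N [e [l [ll lE]]]] oU UO; elim: k f g UO => [|k IH] f g UO.
  by move=> cf cg x Ux; apply: continuous_comp; [exact: cf|apply: cg; exact: UO].
move=> Hf Hg; have Hf' := Ck_onS Hf; have Hg' := Ck_onS Hg.
case: Hf => df Df; case: Hg => dg Dg; split.
  move=> x Ux; apply: differentiable_comp; first exact: df.
  by apply: dg; exact: UO.
move=> v.
have H : Ck_on k U (fun x => \sum_i l i ('D_v f x) * 'D_(e i) g (f x)).
  apply: Ck_on_sum => // i; apply: Ck_onM => //.
    by have [? ?] := ll i; apply: Ck_on_linear_comp => //; exact: Df.
  by apply: (IH f (fun y => 'D_(e i) g y)) => //; exact: Dg.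
apply: (Ck_on_eq oU _ H) => x Ux.
rewrite (derive_comp_coords v lE) //; first exact: df.
by apply: dg; exact: UO.
Qed.

Lemma has_coords_R : has_coords R.
Proof.
exists 1, (fun=> 1), (fun=> id); split.
  by move=> _; split => // x; exact: cvg_id.
by move=> w; rewrite big_ord_recl big_ord0 addr0 /= /GRing.scale /= mulr1.
Qed.

Lemma coord_linear n (i : 'I_n) : linear (fun y : 'rV[R]_n => y ord0 i).
Proof. by move=> a x y; rewrite !mxE. Qed.

Lemma coord_cts n (i : 'I_n) : continuous (fun y : 'rV[R]_n => y ord0 i).
Proof. by move=> x; exact: coord_continuous. Qed.

Lemma has_coords_rV n : has_coords 'rV[R]_n.
Proof.
exists n, (fun i => 'e_i), (fun i (y : 'rV_n) => y ord0 i); split.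
  by move=> i; split; [exact: coord_linear|exact: coord_cts].
by move=> w; rewrite -row_sum_delta.
Qed.

Lemma has_coords_prod V W : has_coords V -> has_coords W ->
  has_coords (V * W)%type.
Proof.
move=> [N [e [l [ll lE]]]] [M [e' [l' [ll' lE']]]].
exists (N + M)%N,
  (fun i => match fintype.split i with inl i => (e i, 0) | inr j => (0, e' j) end),
  (fun i => match fintype.split i with inl i => l i \o fst | inr j => l' j \o snd end).
split.
  move=> i; case: (fintype.split i) => j.
    have [lj cj] := ll j; split; first by move=> a x y; exact: lj.
    by move=> x; apply: continuous_comp; [exact: cvg_fst|exact: cj].
  have [lj cj] := ll' j; split; first by move=> a x y; exact: lj.
  by move=> x; apply: continuous_comp; [exact: cvg_snd|exact: cj].
move=> [x y]; rewrite big_split_ord /=.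
under eq_bigr do rewrite (unsplitK (inl _)) /=.
under [X in _ = _ + X]eq_bigr do rewrite (unsplitK (inr _)) /=.
have H1 (r : seq 'I_N) : \sum_(i <- r) l i x *: (e i, 0 : W) = (\sum_(i <- r) l i x *: e i, 0).
  elim: r => [|i r IH]; first by rewrite !big_nil.
  by rewrite !big_cons IH; congr pair; rewrite /= scaler0 addr0.
have H2 (r : seq 'I_M) : \sum_(i <- r) l' i y *: (0 : V, e' i) = (0, \sum_(i <- r) l' i y *: e' i).
  elim: r => [|i r IH]; first by rewrite !big_nil.
  by rewrite !big_cons IH; congr pair; rewrite /= scaler0 addr0.
by rewrite H1 H2; congr pair; rewrite /= -?lE -?lE' ?addr0 ?add0r.
Qed.
End Ck.

(** * Bump functions *)

Section Flat.
Context {R : realType}.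

Lemma near0_norm_le (V : normedModType R) e : 0 < e ->
  \forall h \near (0 : V), `|h| <= e.
Proof.
move=> e0; apply/nbhs_ballP; exists e => // h.
by rewrite -ball_normE /= sub0r normrN => /ltW.
Qed.

(** The first-order expansion, free of quotients and of the exception at h = 0;
error terms are easier to add in this form. *)
Lemma is_derive1P (f : R -> R) (x d : R) : is_derive x (1 : R) f d <->
  forall e, 0 < e -> \forall h \near (0 : R), `|f (x + h) - f x - h * d| <= e * `|h|.
Proof.
have E : (is_derive x (1 : R) f d) <->
   (h^-1 *: ((f \o shift x) (h *: (1 : R)) - f x)) @[h --> 0^'] --> d.
  split; first by case=> cf <-.
  by move=> H; split; [apply/cvg_ex; exists d|exact: cvg_lim].
rewrite E {E}; split.
  move=> /cvgrPdist_le H e e0; have := H e e0.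
  rewrite near_withinE => {}H; near=> h.
  have [->|h0] := eqVneq h 0; first by rewrite addr0 subrr mul0r subrr !normr0 mulr0.
  have : h != 0 -> `|d - h^-1 *: ((f \o shift x) (h *: (1:R)) - f x)| <= e.
    by near: h; apply: filterS H => t.
  move=> /(_ h0); rewrite /= -[_ *: 1]/(h * 1) mulr1 -[_ *: _]/(_ * _) (addrC h) distrC => H1.
  rewrite (_ : f _ - f x - _ = (h^-1 * (f (x + h) - f x) - d) * h); last by field.
  by rewrite normrM ler_wpM2r.
move=> H; apply/cvgrPdist_le => e e0; rewrite near_withinE.
apply: filterS (H e e0) => h Hh h0.
rewrite /= -[_ *: 1]/(h * 1) mulr1 -[_ *: _]/(_ * _) (addrC h) distrC.
have hp : 0 < `|h| by rewrite normr_gt0.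
rewrite -(ler_pM2r hp) -normrM.
by rewrite (_ : _ * h = f (x + h) - f x - h * d) //; field.
Unshelve. all: by end_near. Qed.

(** The functions p(1/x) exp(- 1/x), extended by 0 to x <= 0. They form a class
closed under differentiation that contains exp(- 1/x). *)
Definition flat (p : {poly R}) (x : R) : R :=
  if 0 < x then p.[x^-1] * expR (- x^-1) else 0.

(** The exponential series bounds (1/x)^(n+1) exp(- 1/x) by (n+1)!. The extra
factor 'X^n makes the induction on [p] possible. *)
Lemma flat_le (p : {poly R}) : exists2 C, 0 <= C &
  forall x, 0 < x -> `|flat p x| <= C * x.
Proof.
suff H n : exists2 C, 0 <= C & forall x, 0 < x -> `|flat ('X^n * p) x| <= C * x.
  by have := H 0%N; rewrite expr0 mul1r.
elim/poly_ind: p n => [|p c IH] n.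
  by exists 0 => // x x0; rewrite /flat x0 mulr0 horner0 !mul0r normr0.
have [C C0 HC] := IH n.+1.
exists (C + `|c| * (n.+1`!)%:R); first by rewrite addr_ge0 // mulr_ge0.
move=> x x0; have := HC x x0; rewrite /flat x0 => H1.
rewrite mulrDr mulrA (mulrC _ 'X) mulrA -exprS hornerD mulrDl mulrDl.
apply: le_trans (ler_normD _ _) _; apply: lerD => //.
rewrite hornerM hornerC hornerXn -mulrA [leLHS]normrM [`|_ * expR _|]normrM mulrCA.
rewrite -mulrA ler_wpM2l //.
rewrite !ger0_norm ?expR_ge0 ?exprn_ge0 ?invr_ge0 ?(ltW x0) // expRN.
have y0 : 0 < x^-1 by rewrite invr_gt0.
have := expR_ge1Dxn n (ltW y0).
set E := expR _; have E0 : 0 < E by exact: expR_gt0.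
have F0 : 0 < (n.+1)`!%:R :> R by rewrite ltr0n fact_gt0.
move=> H.
have H2 : x^-1 ^+ n.+1 <= (n.+1)`!%:R * E.
  rewrite mulrC -ler_pdivrMr //; apply: le_trans H; by rewrite lerDr.
by rewrite ler_pdivrMr // mulrAC -ler_pdivrMr // -exprSr.
Qed.

(** At 0 the bound of [flat_le] for 'X * p shows that [flat p] is O(x^2). *)
Lemma is_derive_flat (p : {poly R}) x :
  is_derive x (1 : R) (flat p) (flat ('X^2 * (p - p^`())) x).
Proof.
have [x0|x0|->] := ltrgtP x 0.
- rewrite {2}/flat ltNge ltW //=.
  apply: (@near_eq_is_derive _ _ _ (cst (0 : R))).
  near=> y; symmetry; rewrite /flat ltNge ltW //=; near: y; exact: lt_nbhsl.
- rewrite {2}/flat x0.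
  have xn0 : x != 0 by rewrite gt_eqF.
  have dinv : is_derive x (1 : R) (fun y : R => y^-1) (- x ^- 2).
    split; first exact: derivableV.
    by rewrite deriveV // derive_id -[_ *: _]/(_ * _) mulr1.
  have d1 : is_derive x (1 : R) (fun x => p.[x^-1]) (- x ^- 2 * p^`().[x^-1]).
    by rewrite mulrC; exact: (@is_derive1_comp _ (horner p) (fun y : R => y^-1) x).
  have d2 : is_derive x (1 : R) (fun x => expR (- x^-1)) (x ^- 2 * expR (- x^-1)).
    rewrite mulrC; apply: (@is_derive1_comp _ expR (fun y : R => - y^-1) x).
    by rewrite -[x ^- 2]opprK; exact: is_deriveN.
  have d3 : is_derive x (1 : R) (fun x => p.[x^-1] * expR (- x^-1))
      (('X^2 * (p - p^`())).[x^-1] * expR (- x^-1)).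
    apply: (trigger_derive (is_deriveM d1 d2)).
    rewrite -![_ *: _]/(_ * _) !hornerE /=; field.
    by rewrite xn0.
  apply: near_eq_is_derive d3.
  by near=> y; rewrite /flat ifT //=; near: y; exact: lt_nbhsr.
- rewrite {2}/flat ltxx; apply/is_derive1P => e e0.
  have [C C0 HC] := flat_le ('X * p).
  have C1 : 0 < C + 1 by rewrite ltr_wpDl.
  have e1 : 0 < e / (C + 1) by rewrite divr_gt0.
  have near1 := @near0_norm_le R _ e1.
  near=> h; rewrite add0r mulr0 subr0 /(flat p 0) ltxx subr0.
  rewrite /flat; case: ifPn => h0; last by rewrite normr0 mulr_ge0 // ltW.
  have := HC h h0; rewrite /flat h0 hornerM hornerX -mulrA normrM normfV (gtr0_norm h0).
  rewrite ler_pdivrMl // => H; apply: le_trans H _.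
  rewrite mulrC ler_pM2r //.
  have -> : C * h <= e; last by [].
  apply: (@le_trans _ _ ((C + 1) * h)); first by rewrite ler_pM2r // lerDl.
  rewrite -ler_pdivlMl // mulrC; apply: le_trans (ler_norm h) _; near: h.
  exact: near1.
Unshelve. all: by end_near. Qed.

Lemma flat_Ck k (p : {poly R}) : Ck_on k [set: R] (flat p).
Proof.
elim: k p => [|k IH] p.
  move=> x _; apply: differentiable_continuous; apply/derivable1_diffP.
  by have dp := is_derive_flat p x; apply: ex_derive.
have df x : differentiable (flat p) x.
  by apply/derivable1_diffP; have dp := is_derive_flat p x; apply: ex_derive.
split => [x _|v]; first exact: df.
apply: (Ck_on_eq openT _ (Ck_onM openT (@Ck_on_cst _ _ _ k _ v) (IH ('X^2 * (p - p^`()))))).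
move=> x _; rewrite deriveE // diff1E // derive1E.
by have dp := is_derive_flat p x; rewrite derive_val.
Qed.

Definition flat0 : R -> R := flat 1.

Lemma flat0_le0 x : x <= 0 -> flat0 x = 0.
Proof. by move=> x0; rewrite /flat0 /flat ltNge x0. Qed.

Lemma flat0_gt0 x : 0 < x -> 0 < flat0 x.
Proof. by move=> x0; rewrite /flat0 /flat x0 hornerC mul1r expR_gt0. Qed.

Lemma flat0_homo x y : 0 < x -> x <= y -> flat0 x <= flat0 y.
Proof.
move=> x0 xy; have y0 := lt_le_trans x0 xy.
by rewrite /flat0 /flat x0 y0 !hornerC !mul1r ler_expR lerN2 lef_pV2.
Qed.

(** With q the squared distance to y0, take
theta = flat0 (1 - K1 * flat0 (q - rho)) / flat0 1. Where q <= rho the inner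
function vanishes and theta = 1; where q >= 2 rho it is at least 1 / K1, the
outer argument is nonpositive and theta = 0. *)
Lemma smooth_bump n (y0 : 'rV[R]_n) (B : set 'rV[R]_n) : nbhs y0 B ->
  exists theta : 'rV[R]_n -> R, exists K : set 'rV[R]_n,
  [/\ smooth_on setT theta, \forall y \near y0, theta y = 1,
      compact K, K `<=` B & forall y, ~ K y -> theta y = 0].
Proof.
move=> /nbhs_ballP[e /= e0 eB].
pose rho := (e / 2) ^+ 2 / 2.
have rho0 : 0 < rho by rewrite divr_gt0 // exprn_gt0 // divr_gt0.
pose q (y : 'rV[R]_n) := \sum_(i < n) (y ord0 i - y0 ord0 i) * (y ord0 i - y0 ord0 i).
have Ckq k : Ck_on k setT q.
  apply: Ck_on_sum => [|i]; first exact: openT.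
  have H : Ck_on k setT (fun y : 'rV[R]_n => y ord0 i - y0 ord0 i).
    apply: Ck_onD; [exact: openT| |exact: Ck_on_cst].
    by apply: Ck_on_linear; [exact: coord_linear|exact: coord_cts].
  by apply: Ck_onM; [exact: openT|exact: H|exact: H].
pose K1 := (flat0 rho)^-1.
pose theta y := flat0 (1 - K1 * flat0 (q y - rho)) * (flat0 1)^-1.
exists theta, [set y : 'rV[R]_n | forall i,
  `[y0 ord0 i - e / 2, y0 ord0 i + e / 2]%classic (y ord0 i)].
have q0 : q y0 = 0 by rewrite /q big1 // => i _; rewrite subrr mul0r.
split.
- move=> k; apply: Ck_onM; [exact: openT| |exact: Ck_on_cst].
  apply: (@Ck_on_comp _ _ _ _ _ setT (fun y => 1 - K1 * flat0 (q y - rho)) flat0) => //.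
  + exact: has_coords_R.
  + exact: openT.
  + have := @Ck_onD _ _ _ k setT (fun=> 1 : R) (fun y => (- K1) * flat0 (q y - rho)) openT.
    rewrite (_ : (fun x => 1 + _) = (fun y => 1 - K1 * flat0 (q y - rho))); last first.
      by apply/funext => y; rewrite mulNr.
    apply; first exact: Ck_on_cst.
    apply: Ck_onM; [exact: openT|exact: Ck_on_cst|].
    apply: (@Ck_on_comp _ _ _ _ _ setT (fun y => q y - rho) flat0) => //.
    * exact: has_coords_R.
    * exact: openT.
    * by apply: Ck_onD; [exact: openT|exact: Ckq|exact: Ck_on_cst].
    * exact: flat_Ck.
  + exact: flat_Ck.
- have cq : {for y0, continuous q} by exact: (Ckq 0).
  have : \forall y \near y0, q y < rho.
    by move/cvgrPdist_lt: (cq) => /(_ _ rho0); apply: filterS => y; rewrite q0 sub0r normrN; exact: le_lt_trans (ler_norm _).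
  apply: filterS => y qy; rewrite /theta (@flat0_le0 (q y - rho)) ?subr_le0 ?ltW //.
  by rewrite mulr0 subr0 divff // gt_eqF // flat0_gt0.
- exact: (@rV_compact _ _ (fun i => `[y0 ord0 i - e / 2, y0 ord0 i + e / 2]%classic) (fun i => @segment_compact _ _ _)).
- move=> y Hy; apply: eB; split => // i j; rewrite (ord1 i) /ball /=.
  have := Hy j; rewrite /= in_itv /= => /andP[h1 h2].
  have : `|y0 ord0 j - y ord0 j| <= e / 2 by rewrite ler_norml; lra.
  by move/le_lt_trans; apply; lra.
- move=> y /existsNP[i Hi].
  have H2 : e / 2 < `|y ord0 i - y0 ord0 i|.
    rewrite ltNge; apply/negP; rewrite ler_norml => /andP[h1 h2].
    by apply: Hi; rewrite /= in_itv /=; lra.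
  have Hq : rho + rho < q y.
    apply: (@lt_le_trans _ _ ((y ord0 i - y0 ord0 i) ^+ 2)).
      rewrite -real_normK ?num_real // (_ : rho + rho = (e / 2) ^+ 2); last by rewrite /rho; field.
      by rewrite ltrXn2r // ?nnegrE ?divr_ge0 // ltW.
    rewrite /q (bigD1 i) //= -expr2 lerDl; apply: sumr_ge0 => j _.
    by rewrite -expr2 sqr_ge0.
  rewrite /theta (@flat0_le0 (1 - _)) ?mul0r // subr_le0.
  rewrite /K1 ler_pdivlMl ?flat0_gt0 // mulr1; apply: flat0_homo => //.
  by rewrite lerBrDr ltW.
Qed.

End Flat.

(** * Smooth functions on open sets and on manifolds *)

Section SmoothOn.
Context {R : realType}.
Implicit Types (V W : normedModType R).

Lemma smooth_on_eq V W (U : set V) (f g : V -> W) : open U ->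
  (forall x, U x -> f x = g x) -> smooth_on U f -> smooth_on U g.
Proof. by move=> oU fg Hf k; exact: Ck_on_eq oU fg (Hf k). Qed.

Lemma smooth_on_local V W (U : set V) (f : V -> W) :
  (forall x, U x -> exists2 B : set V, B x & smooth_on B f) -> smooth_on U f.
Proof.
by move=> H k; apply: Ck_on_local => x /H[B Bx Hf]; exists B => //; exact: Hf.
Qed.

Lemma smooth_onW V W (U B : set V) (f : V -> W) : U `<=` B ->
  smooth_on B f -> smooth_on U f.
Proof. by move=> UB Hf k; exact: Ck_onW UB (Hf k). Qed.

Lemma smooth_on_cst V W (U : set V) (w : W) : smooth_on U (fun _ : V => w).
Proof. by move=> k; exact: Ck_on_cst. Qed.

Lemma smooth_onD V W (U : set V) (f g : V -> W) : open U ->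
  smooth_on U f -> smooth_on U g -> smooth_on U (fun x => f x + g x).
Proof. by move=> oU Hf Hg k; apply: Ck_onD. Qed.

Lemma smooth_onM V (U : set V) (f g : V -> R) : open U ->
  smooth_on U f -> smooth_on U g -> smooth_on U (fun x => f x * g x).
Proof. by move=> oU Hf Hg k; apply: Ck_onM. Qed.

Lemma smooth_on_sum V W (U : set V) (I : Type) (r : seq I) (f : I -> V -> W) :
  open U -> (forall i, smooth_on U (f i)) ->
  smooth_on U (fun x => \sum_(i <- r) f i x).
Proof. by move=> oU Hf k; apply: Ck_on_sum => // i; exact: Hf. Qed.

Lemma smooth_on_linear V W (U : set V) (l : V -> W) : linear l ->
  continuous l -> smooth_on U l.
Proof. by move=> ll cl k; exact: Ck_on_linear. Qed.

Lemma smooth_on_comp V W (U : set V) (O : set W) (f : V -> W) (g : W -> R) :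
  has_coords W -> open U -> (forall x, U x -> O (f x)) ->
  smooth_on U f -> smooth_on O g -> smooth_on U (g \o f).
Proof. by move=> cW oU UO Hf Hg k; exact: Ck_on_comp cW oU UO (Hf k) (Hg k). Qed.

Lemma smooth_on_derive V W (U : set V) (f : V -> W) v : smooth_on U f ->
  smooth_on U (fun x => 'D_v f x).
Proof. by move=> Hf k; have [_ Df] := Hf k.+1; exact: Df. Qed.

Lemma smooth_on_differentiable V W (U : set V) (f : V -> W) x : smooth_on U f ->
  U x -> differentiable f x.
Proof. by move=> Hf Ux; have [df _] := Hf 1%N; exact: df. Qed.

Lemma smooth_on_continuous V W (U : set V) (f : V -> W) x : smooth_on U f ->
  U x -> {for x, continuous f}.
Proof. by move=> Hf Ux; exact: (Hf 0%N). Qed.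

Lemma smooth_ext_rV n (B : set 'rV[R]_n) (g : 'rV[R]_n -> R) y0 : open B ->
  B y0 -> smooth_on B g -> exists G, exists K : set 'rV[R]_n,
  [/\ smooth_on setT G, \forall y \near y0, G y = g y,
      compact K, K `<=` B & forall y, ~ K y -> G y = 0].
Proof.
move=> oB By0 Hg.
have [theta [K [st t1 cK KB tK]]] := smooth_bump (open_nbhs_nbhs (conj oB By0)).
exists (fun y => theta y * g y), K; split => //; last first.
- by move=> y /tK ->; rewrite mul0r.
- by apply: filterS t1 => y ->; rewrite mul1r.
apply: smooth_on_local => y _; have [By|nBy] := pselect (B y).
  exists B => //; apply: smooth_onM => //; exact: smooth_onW st.
exists (~` K); first by move=> /KB.
have oK : open (~` K).
  by apply: closed_openC; apply: compact_closed cK; exact: norm_hausdorff.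
apply: (smooth_on_eq oK _ (@smooth_on_cst _ _ _ 0)) => z /tK ->.
by rewrite mul0r.
Qed.

End SmoothOn.

Section Manifold.
Context {R : realType} {n : nat} {M : manifoldType R n}.
Implicit Types (c d : chart R n M).

Definition chart_im c := c @` chart_dom c.

Lemma chart_imP c y : chart_im c y ->
  chart_dom c (chart_inv c y) /\ c (chart_inv c y) = y.
Proof. by move=> [x xc <-]; rewrite chart_funK. Qed.

Lemma chart_im_fun c x : chart_dom c x -> chart_im c (c x).
Proof. by move=> cx; exists x. Qed.

Lemma open_chart_preim c (A : set M) : open A ->
  open [set y | chart_im c y /\ A (chart_inv c y)].
Proof.
move=> oA; rewrite openE => y [cy Ay]; rewrite /interior /=.
have H1 : nbhs y (chart_im c) by apply: open_nbhs_nbhs; split => //; exact: open_chart_im.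
have H2 : nbhs y [set y | A (chart_inv c y)].
  by apply: (chart_inv_continuous cy); exact: open_nbhs_nbhs.
by apply: filterS2 H1 H2.
Qed.

(** One chart around each point is enough, by compatibility of the atlas. *)
Lemma smooth_fun_local (f : M -> R) :
  (forall x, exists c, [/\ atlas c, chart_dom c x &
     exists B, [/\ open B, B (c x), B `<=` chart_im c &
       smooth_on B (f \o chart_inv c)]]) -> smooth_fun f.
Proof.
move=> H d ad; apply: smooth_on_local => y dy.
have [dx dxy] := chart_imP dy.
have [c [ac cx [B [oB Bx BI sf]]]] := H (chart_inv d y).
pose A := chart_dom c `&` c @^-1` B.
have oA : open A.
  rewrite openE => z [cz Bz]; rewrite /interior /=.
  apply: filterI; first by apply: open_nbhs_nbhs; split => //; exact: open_chart_dom.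
  by apply: (chart_fun_continuous cz); exact: open_nbhs_nbhs.
exists [set y | chart_im d y /\ A (chart_inv d y)] => //.
have oE := @open_chart_preim d _ oA.
have st : smooth_on [set y | chart_im d y /\ A (chart_inv d y)] (c \o chart_inv d).
  apply: (smooth_onW _ (atlas_compatible d c ad ac)) => z [dz [cz _]].
  by have [? ?] := chart_imP dz; exists (chart_inv d z).
have := smooth_on_comp (has_coords_rV n) oE _ st sf; move=> {}H.
have {}H := H (fun z (Hz : [set y | chart_im d y /\ A (chart_inv d y)] z) => Hz.2.2).
apply: (smooth_on_eq oE _ H) => z [dz [cz _]] /=.
by rewrite chart_funK.
Qed.

(** The extension by 0 is smooth because its support lies in the image of a
compact set, which is closed as the manifold is Hausdorff. *)
Lemma smooth_ext c x0 (B : set 'rV[R]_n) (g : 'rV[R]_n -> R) :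
  atlas c -> chart_dom c x0 -> open B -> B (c x0) -> B `<=` chart_im c ->
  smooth_on B g ->
  exists F : M -> R, [/\ smooth_fun F, \forall x \near x0, F x = g (c x) &
    forall x, F x != 0 -> chart_dom c x /\ B (c x)].
Proof.
move=> ac cx0 oB Bx0 BI sg.
have [G [K [sG Gg cK KB GK]]] := smooth_ext_rV oB Bx0 sg.
pose F x := if pselect (chart_dom c x) then G (c x) else 0.
have FE x : chart_dom c x -> F x = G (c x) by rewrite /F; case: pselect.
have FN x : ~ chart_dom c x -> F x = 0 by rewrite /F; case: pselect.
exists F; split; last first.
- move=> x; have [cx|ncx] := pselect (chart_dom c x); last first.
    by rewrite FN // eqxx.
  rewrite (FE _ cx) => H; split => //; apply: KB; apply: contrapT => /GK E.
  by rewrite E eqxx in H.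
- have H1 : \forall x \near x0, chart_dom c x.
    by apply: open_nbhs_nbhs; split => //; exact: open_chart_dom.
  have H2 : \forall x \near x0, G (c x) = g (c x) by exact: (chart_fun_continuous cx0 Gg).
  by apply: filterS2 H1 H2 => x cx <-; exact: FE.
apply: smooth_fun_local => x.
have [cx|ncx] := pselect (chart_dom c x).
  exists c; split => //; exists (chart_im c); split => //.
  - exact: open_chart_im.
  - exact: chart_im_fun.
  apply: (smooth_on_eq (@open_chart_im _ _ _ c) _ (smooth_onW _ sG)) => // y.
  by move=> /chart_imP[cy cyy]; rewrite /= FE // cyy.
have [d ad dx] := atlas_cover x.
have clK : closed (chart_inv c @` K).
  apply: compact_closed; first exact: manifold_hausdorff.
  apply: continuous_compact => //; apply: continuous_in_subspaceT => y.
  by rewrite inE => /KB /BI; exact: chart_inv_continuous.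
have oK := closed_openC clK.
exists d; split => //; exists [set y | chart_im d y /\ (~` (chart_inv c @` K)) (chart_inv d y)].
have oE := @open_chart_preim d _ oK.
split => //.
- split; first exact: chart_im_fun.
  rewrite chart_funK // => -[y Ky yx]; apply: ncx; rewrite -yx.
  by have [] := chart_imP (BI _ (KB _ Ky)).
- by move=> y [].
apply: (smooth_on_eq oE _ (@smooth_on_cst _ _ _ _ 0)) => y [dy Hy] /=.
have [cy|ncy] := pselect (chart_dom c (chart_inv d y)); last by rewrite FN.
rewrite FE //; symmetry; apply: GK => KK; apply: Hy.
by exists (c (chart_inv d y)) => //; rewrite chart_funK.
Qed.

Lemma smooth_fun_bump (x0 : M) (A : set M) : nbhs x0 A ->
  exists theta : M -> R, [/\ smooth_fun theta, \forall x \near x0, theta x = 1 &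
    forall x, ~ A x -> theta x = 0].
Proof.
rewrite nbhsE => -[A' [oA' A'x0] A'A].
have [c ac cx0] := atlas_cover x0.
have oE := @open_chart_preim c _ oA'.
have [||F [sF F1 F0]] := @smooth_ext c x0 _ (fun=> 1) ac cx0 oE _ _ (@smooth_on_cst _ _ _ _ (1 : R)).
- by split; [exact: chart_im_fun|rewrite chart_funK].
- by move=> y [].
exists F; split => // x nAx; apply/eqP; apply: contrapT => /negP /F0 [cx [_]].
by rewrite chart_funK // => /A'A.
Qed.

Lemma smooth_fun_cst (a : R) : smooth_fun (fun _ : M => a).
Proof. by move=> c _; exact: smooth_on_cst. Qed.

Lemma smooth_funD (f g : M -> R) : smooth_fun f -> smooth_fun g ->
  smooth_fun (fun x => f x + g x).
Proof.
move=> sf sg c ac; apply: smooth_onD (sf c ac) (sg c ac).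
exact: open_chart_im.
Qed.

Lemma smooth_funM (f g : M -> R) : smooth_fun f -> smooth_fun g ->
  smooth_fun (fun x => f x * g x).
Proof.
move=> sf sg c ac; apply: smooth_onM (sf c ac) (sg c ac).
exact: open_chart_im.
Qed.

Lemma smooth_fun_sum (I : Type) (r : seq I) (f : I -> M -> R) :
  (forall i, smooth_fun (f i)) -> smooth_fun (fun x => \sum_(i <- r) f i x).
Proof.
move=> sf c ac; apply: smooth_on_sum => [|i]; last exact: sf.
exact: open_chart_im.
Qed.

Lemma smooth_fun_continuous (f : M -> R) : smooth_fun f -> continuous f.
Proof.
move=> sf x; have [c ac cx] := atlas_cover x.
have cf := smooth_on_continuous (sf c ac) (chart_im_fun cx).
have H := continuous_comp (chart_fun_continuous cx) cf.
apply: cvg_trans (_ : (f \o chart_inv c \o c) @ x --> f x).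
  apply: near_eq_cvg.
  have := open_nbhs_nbhs (conj (open_chart_dom c) cx).
  by apply: filterS => y cy /=; rewrite chart_funK.
by move: H; rewrite /prop_for /continuous_at /= chart_funK.
Qed.

End Manifold.

(** * Antiderivatives and mean value estimates *)

(** The antiderivative vanishing at 0. Integrating from -1 puts 0 and 1 in the
interior of the domain where the fundamental theorem of calculus applies. *)
HB.lock Definition prim {R : realType} (f : R -> R) (x : R) : R :=
  (\int[lebesgue_measure]_(t in `[-1, x]) f t -
   \int[lebesgue_measure]_(t in `[-1, 0%R]) f t)%R.

Section Antiderivative.
Context {R : realType}.
Implicit Types (f g G : R -> R).

Lemma prim0 f : prim f 0 = 0.
Proof. by rewrite prim.unlock subrr. Qed.

Lemma is_derive_prim f (x : R) : continuous f -> -1 < x < 2 ->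
  is_derive x (1 : R) (prim f) (f x).
Proof.
move=> cf /andP[x1 x2].
have intf : lebesgue_measure.-integrable `[-1, 2%R] (EFin \o f).
  apply: continuous_compact_integrable; first exact: segment_compact.
  exact: continuous_subspaceT.
have [d1 d2] := continuous_FTC1_closed x2 intf x1 (cf x).
have d3 : is_derive x (1 : R) (fun x => \int[lebesgue_measure]_(t in `[-1, x]) f t)%R (f x).
  by apply: DeriveDef; [exact: d1|rewrite -derive1E].
have d4 := is_deriveB d3 (is_derive_cst (\int[lebesgue_measure]_(t in `[-1, 0%R]) f t)%R x (1 : R)).
by rewrite prim.unlock; apply: (trigger_derive d4); rewrite subr0.
Qed.

Lemma is_derive_continuous f (x d : R) : is_derive x (1 : R) f d ->
  {for x, continuous f}.
Proof.
by move=> df; apply: differentiable_continuous; apply/derivable1_diffP; exact: ex_derive.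
Qed.

Lemma is_derive_fsum (V : normedModType R) n (h : 'I_n -> V -> R) (x v : V)
    (dh : 'I_n -> R) : (forall i, is_derive x v (h i) (dh i)) ->
  is_derive x v (fun y => \sum_(i < n) h i y) (\sum_(i < n) dh i).
Proof.
move=> H; have := is_derive_sum H.
by rewrite (_ : \sum_(i < n) h i = (fun y => \sum_(i < n) h i y)) // fct_sumE.
Qed.

Lemma is_derive_mull (V : normedModType R) (c : R) (f : V -> R) (x v : V) (d : R) :
  is_derive x v f d -> is_derive x v (fun y => c * f y) (c * d).
Proof. exact: is_deriveZ. Qed.

Lemma MVT0 G g (h : R) : 0 <= h ->
  (forall s, s \in `[0, h] -> is_derive s (1 : R) G (g s)) ->
  exists2 c, c \in `[0, h] & G h - G 0 = g c * h.
Proof.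
move=> h0 dG.
have H1 (s : R) : s \in `]0, h[ -> is_derive s (1 : R) G (g s).
  by move=> /subset_itv_oo_cc; exact: dG.
have H2 : {within `[0, h], continuous G}.
  by apply: derivable_within_continuous => s /dG ds; exact: ex_derive.
by have [c c0h] := MVT_segment h0 H1 H2; rewrite subr0; exists c.
Qed.

(** The derivative is given on ]-1, 2[, the neighbourhood of [0, 1] on which
[is_derive_prim] provides it. *)
Lemma MVT_le G g (x e : R) : 0 <= x < 2 ->
  (forall t : R, -1 < t < 2 -> is_derive t (1 : R) G (g t)) ->
  (forall t : R, 0 <= t <= x -> `|g t| <= e) -> `|G x - G 0| <= e * x.
Proof.
move=> /andP[x0 x2] dG Hg.
have [||c] := @MVT_segment _ G g 0 x x0.
- move=> t; rewrite in_itv /= => /andP[t0 tx]; apply: dG.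
  by rewrite (lt_trans _ t0) ?ltrN10 ?(lt_trans tx).
- apply: derivable_within_continuous => t; rewrite in_itv /= => /andP[t0 tx].
  have : -1 < t < 2 by rewrite (lt_le_trans _ t0) ?ltrN10 ?(le_lt_trans tx).
  by move=> /dG dt; exact: ex_derive.
rewrite in_itv /= => /Hg H ->.
by rewrite subr0 normrM (ger0_norm x0) ler_wpM2r.
Qed.

Lemma prim_le f (x e : R) : continuous f -> 0 <= x < 2 ->
  (forall t : R, 0 <= t <= x -> `|f t| <= e) -> `|prim f x| <= e * x.
Proof.
move=> cf x02 H; rewrite -[prim f x]subr0 -(prim0 f).
by apply: (@MVT_le _ f) => // t ht; exact: is_derive_prim.
Qed.

Lemma prim_eq f G (x : R) : continuous f -> 0 <= x < 2 ->
  (forall t : R, -1 < t < 2 -> is_derive t (1 : R) G (f t)) ->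
  prim f x = G x - G 0.
Proof.
move=> cf x02 dG; apply/eqP; rewrite -subr_eq0 -normr_le0.
have := @MVT_le (prim f - G) (fun=> 0) x 0 x02; rewrite mul0r !fctE prim0.
move=> H; apply: le_trans (H _ _) => [|t ht|t _]; last by rewrite normr0.
  by rewrite sub0r opprK opprB addrA addrAC.
rewrite -(subrr (f t)); apply: is_deriveB; [exact: is_derive_prim|exact: dG].
Qed.

(** Uniformity in [t] comes from the compactness of [0, 1]. *)
Lemma segment_unif (T : topologicalType) (phi : R -> T -> R) (x0 : T) :
  (forall t : R, 0 <= t <= 1 -> {for (t, x0), continuous (fun p : R * T => phi p.1 p.2)}) ->
  forall e, 0 < e -> \forall x \near x0, forall t : R, 0 <= t <= 1 ->
    `|phi t x - phi t x0| <= e.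
Proof.
move=> cphi e e0.
have e20 : 0 < e / 2 by rewrite divr_gt0.
have /compact_near_coveringP cK := @segment_compact R 0 1.
have := cK T (nbhs x0) (fun x t => `|phi t x - phi t x0| <= e) (@nbhs_filter _ x0).
move=> H; apply: filterS (H _) => [x Hx t t01|t]; first by apply: Hx; rewrite /= in_itv.
rewrite /= in_itv /= => /cphi /cvgrPdist_lt /(_ _ e20) /= [[A B] [/= At Bx] AB].
exists (A, B) => // -[t' x] [/= At' Bx'].
rewrite -(subrKA (phi t x0)); apply: le_trans (ler_normD _ _) _.
rewrite [leRHS](splitr e); apply: lerD; last first.
  by apply: ltW; apply: (AB (t', x0)); split => //; exact: nbhs_singleton.
by rewrite distrC; apply: ltW; apply: (AB (t', x)).
Qed.

End Antiderivative.

(** * The lemma of Hadamard *)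

Section Hadamard.
Context {R : realType}.

Lemma is_derive_line (V W : normedModType R) (F : V -> W) (a b : V) (t : R) :
  differentiable F (a + t *: b) ->
  is_derive t (1 : R) (fun s : R => F (a + s *: b)) ('D_b F (a + t *: b)).
Proof.
move=> dF.
have E : (fun h : R => h^-1 *: (((fun s : R => F (a + s *: b)) \o shift t) (h *: (1 : R)) -
    F (a + t *: b))) =
  (fun h : R => h^-1 *: ((F \o shift (a + t *: b)) (h *: b) - F (a + t *: b))).
  apply/funext => h /=; congr (_ *: (F _ - _)).
  by rewrite -[h *: 1]/(h * 1) mulr1 scalerDl addrCA.
have d := @diff_derivable _ _ _ F _ b dF; split.
  by rewrite /derivable E.
by rewrite /derive E.
Qed.

Lemma coord_norm_le n (h : 'rV[R]_n) i : `|h ord0 i| <= `|h|.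
Proof.
rewrite [leRHS]mx_normrE.
exact: (le_bigmax _ (fun ij : 'I_1 * 'I_n => `|h ij.1 ij.2|) (ord0, i)).
Qed.

Lemma rV_norm_le n (h : 'rV[R]_n) r : 0 <= r -> (forall i, `|h ord0 i| <= r) ->
  `|h| <= r.
Proof.
move=> r0 H; rewrite [leLHS]mx_normrE; apply: bigmax_le => // -[i j] _ /=.
by rewrite (ord1 i).
Qed.

Lemma derive_rV n (F : 'rV[R]_n -> R) y v : differentiable F y ->
  'D_v F y = \sum_(i < n) v ord0 i * 'D_('e_i) F y.
Proof.
move=> dF; rewrite deriveE // {1}(row_sum_delta v) linear_sum.
by apply: eq_bigr => i _; rewrite linearZ /= (deriveE _ dF).
Qed.

Lemma differentiable_intro (V W : normedModType R) (f : V -> W) (x : V)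
    (df : {linear V -> W}) : continuous df ->
  (forall e : R, 0 < e -> \forall h \near (0 : V),
    `|f (x + h) - f x - df h| <= e * `|h|) ->
  differentiable f x /\ 'd f x = df :> (V -> W).
Proof.
move=> cdf H.
have HL : f \o shift x = cst (f x) + df +o_ 0 id.
  apply/eqaddoP => e e0; apply: filterS (H e e0) => h.
  by rewrite !fctE /= opprD addrA [h + x]addrC.
have dE := diff_unique cdf HL.
by split => //; apply/diff_locallyP; rewrite dE.
Qed.

Lemma differentiable_rV n (F : 'rV[R]_n -> R) (y : 'rV[R]_n) (c : 'I_n -> R) :
  (forall e : R, 0 < e -> \forall h \near (0 : 'rV[R]_n),
    `|F (y + h) - F y - \sum_(i < n) h ord0 i * c i| <= e * `|h|) ->
  differentiable F y /\ forall v, 'D_v F y = \sum_(i < n) v ord0 i * c i.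
Proof.
move=> H; pose l (h : 'rV[R]_n) := \sum_(i < n) h ord0 i * c i.
have ll : linear l.
  move=> a u v; rewrite /l /GRing.scale /= mulr_sumr -big_split /=.
  by apply: eq_bigr => i _; rewrite !mxE mulrDl mulrA.
have cl : continuous l.
  have sl : smooth_on setT l.
    apply: smooth_on_sum => [|i]; first exact: openT.
    apply: smooth_onM; [exact: openT| |exact: smooth_on_cst].
    by apply: smooth_on_linear; [exact: coord_linear|exact: coord_cts].
  by move=> x; exact: smooth_on_continuous sl _.
pose L : {linear 'rV[R]_n -> R} := HB.pack l (GRing.isLinear.Build _ _ _ _ l ll).
have cL : continuous L by [].
have [dF dE] := differentiable_intro cL H.
by split => // v; rewrite deriveE // dE.
Qed.

(** The integral of t^k g(y0 + t (y - y0)) for t in [0, 1]. The weight t^k makes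
this family closed under differentiation in [y]. *)
Definition segment_mean n (y0 : 'rV[R]_n) k (g : 'rV[R]_n -> R) (y : 'rV[R]_n) :=
  prim (fun t : R => t ^+ k * g (y0 + t *: (y - y0))) 1.

Section SegmentMean.
Variables (n : nat) (y0 : 'rV[R]_n).

Let integrand k g (y : 'rV[R]_n) (t : R) : R := t ^+ k * g (y0 + t *: (y - y0)).

Let integrand_cts k g t y : continuous g ->
  {for (t, y), continuous (fun p : R * 'rV[R]_n => integrand k g p.2 p.1)}.
Proof.
move=> cg; apply: cvgM.
  apply: (@continuous_comp _ _ _ fst (fun t : R => t ^+ k)); first exact: cvg_fst.
  exact: exprn_continuous.
apply: (@continuous_comp _ _ _ (fun p : R * 'rV[R]_n => y0 + p.1 *: (p.2 - y0)) g); last exact: cg.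
apply: cvgD; first exact: cvg_cst.
apply: cvgZ; first exact: cvg_fst.
by apply: cvgB; [exact: cvg_snd|exact: cvg_cst].
Qed.

Let integrand_cts1 k g y : continuous g -> continuous (integrand k g y).
Proof.
move=> cg t.
apply: (@continuous_comp _ _ _ (fun t : R => (t, y)) (fun p => integrand k g p.2 p.1)).
  by apply: (@cvg_pair _ _ _ (nbhs t) (nbhs t) (nbhs y)); [exact: cvg_id|exact: cvg_cst].
exact: integrand_cts.
Qed.

Lemma segment_mean_continuous k g (y : 'rV[R]_n) : continuous g ->
  {for y, continuous (segment_mean y0 k g)}.
Proof.
move=> cg; apply/(@cvgrPdist_le _ _ _ _ (@nbhs_filter 'rV[R]_n y)) => e e0.
have := @segment_unif R _ (fun t y => integrand k g y t) y (fun t _ => @integrand_cts k g t y cg) e e0.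
apply: filterS => y' Hy'.
have d z := is_derive_prim (@integrand_cts1 k g z cg).
have := @MVT_le R (prim (integrand k g y) - prim (integrand k g y'))
  (fun t => integrand k g y t - integrand k g y' t) 1 e.
rewrite mulr1 !fctE !prim0 subrr subr0; apply.
- by rewrite ler01 ltr1n.
- by move=> t ht; apply: is_deriveB; exact: d.
- by move=> t /Hy'; rewrite distrC.
Qed.

(** Differentiation under the integral sign. The difference between the
increment and its linear part is again an integral, bounded through its integrand:
there the mean value inequality along the segment from z to z + t h leaves the
variation of the partial derivatives, uniformly small by [segment_unif]. *)
Lemma segment_mean_derive k g : (forall x, differentiable g x) ->
  (forall i, continuous (fun x => 'D_('e_i) g x)) -> forall y,
  differentiable (segment_mean y0 k g) y /\
  forall v, 'D_v (segment_mean y0 k g) y =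
    \sum_(i < n) v ord0 i * segment_mean y0 k.+1 (fun x => 'D_('e_i) g x) y.
Proof.
move=> dg cdg y; apply: differentiable_rV => e e0.
have cg : continuous g by move=> x; exact: differentiable_continuous.
(* Each of the n partial derivatives may vary by e / (n + 1). *)
pose e' := e / n.+1%:R.
have e'0 : 0 < e' by rewrite divr_gt0.
have near1 i : \forall h \near (0 : 'rV[R]_n), forall t, 0 <= t <= 1 ->
    `|'D_('e_i) g (y0 + t *: (y - y0) + h) - 'D_('e_i) g (y0 + t *: (y - y0))| <= e'.
  have := @segment_unif R _ (fun t h => 'D_('e_i) g (y0 + t *: (y - y0) + h)) 0.
  move=> H; have {}H := H _ _ e'0.
  apply: filterS (H _) => [h Hh t /Hh|t _]; first by rewrite addr0.
  apply: (@continuous_comp _ _ _ (fun p : R * 'rV[R]_n => y0 + p.1 *: (y - y0) + p.2)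
    (fun x => 'D_('e_i) g x)); last exact: cdg.
  apply: cvgD; last exact: cvg_snd.
  apply: cvgD; first exact: cvg_cst.
  by apply: cvgZr_tmp; exact: cvg_fst.
have near2 : \forall h \near (0 : 'rV[R]_n), forall i t, 0 <= t <= 1 ->
    `|'D_('e_i) g (y0 + t *: (y - y0) + h) - 'D_('e_i) g (y0 + t *: (y - y0))| <= e'.
  exact: (@filter_forall _ _ _ (nbhs (0 : 'rV[R]_n))).
have /nbhs_ballP[r /= r0 Hr] := near2.
apply/nbhs_ballP; exists r => //= h; rewrite -ball_normE /= sub0r normrN => hr.
have {}Hr z : `|z| < r -> forall i t, 0 <= t <= 1 ->
    `|'D_('e_i) g (y0 + t *: (y - y0) + z) - 'D_('e_i) g (y0 + t *: (y - y0))| <= e'.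
  by move=> zr; apply: Hr; rewrite -ball_normE /= sub0r normrN.
have d1 z := is_derive_prim (@integrand_cts1 k g z cg).
have d2 i := is_derive_prim (@integrand_cts1 k.+1 (fun x => 'D_('e_i) g x) y (cdg i)).
(* The increment of the mean minus its linear part, as the value at 1 of an
   antiderivative. *)
have := @MVT_le R
  (fun x => prim (integrand k g (y + h)) x - prim (integrand k g y) x -
     \sum_(i < n) h ord0 i * prim (integrand k.+1 (fun x => 'D_('e_i) g x) y) x)
  (fun t => integrand k g (y + h) t - integrand k g y t -
     \sum_(i < n) h ord0 i * integrand k.+1 (fun x => 'D_('e_i) g x) y t) 1 (e * `|h|).
rewrite mulr1 !prim0 subrr sub0r.
rewrite [X in _ - - X]big1 ?oppr0 ?addr0; last by move=> i _; rewrite prim0 mulr0.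
move=> H; refine (H _ _ _); first by rewrite ler01 ltr1n.
  move=> t ht; apply: is_deriveB; first by apply: is_deriveB; exact: d1.
  by apply: is_derive_fsum => i; apply: is_derive_mull; exact: d2.
move=> t t01.
set z := y0 + t *: (y - y0).
have -> : integrand k g (y + h) t - integrand k g y t -
     \sum_(i < n) h ord0 i * integrand k.+1 (fun x => 'D_('e_i) g x) y t =
  t ^+ k * (g (z + t *: h) - g z - t * \sum_(i < n) h ord0 i * 'D_('e_i) g z).
  rewrite /integrand -/z (_ : y0 + t *: (y + h - y0) = z + t *: h); last first.
    by rewrite /z (addrAC y) scalerDr addrA.
  rewrite !mulrBr mulrA mulr_sumr; congr (_ - _); apply: eq_bigr => i _.
  by rewrite -/z exprSr; ring.
have [t0 t1] := andP t01.
rewrite normrM ger0_norm ?exprn_ge0 //.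
apply: (@le_trans _ _ (1 * (e * `|h|))); last by rewrite mul1r.
apply: ler_pM => //; [exact: exprn_ge0|exact: exprn_ile1|].
(* The same estimate for the integrand, along the segment from z to z + t h. *)
have := @MVT_le R (fun s => g (z + s *: (t *: h)) - s * (t * \sum_(i < n) h ord0 i * 'D_('e_i) g z))
  (fun s => \sum_(i < n) t * h ord0 i * ('D_('e_i) g (z + s *: (t *: h)) - 'D_('e_i) g z)) 1 (e * `|h|).
rewrite mulr1 scale1r mul1r scale0r addr0 mul0r subr0 addrAC; apply.
- by rewrite ler01 ltr1n.
- move=> s hs.
  have h1 := is_derive_line (dg (z + s *: (t *: h))).
  have h2 : is_derive s (1 : R) (fun s : R => s * (t * \sum_(i < n) h ord0 i * 'D_('e_i) g z))
     (t * \sum_(i < n) h ord0 i * 'D_('e_i) g z).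
    have := is_deriveM (is_derive_id s (1 : R)) (is_derive_cst (t * \sum_(i < n) h ord0 i * 'D_('e_i) g z) s (1 : R)).
    by move=> h2; apply: (trigger_derive h2); rewrite scaler0 add0r -[_ *: _]/(_ * _) mulr1.
  apply: (trigger_derive (is_deriveB h1 h2)).
  rewrite derive_rV // mulr_sumr -sumrB; apply: eq_bigr => i _.
  by rewrite !mxE; ring.
- move=> s /andP[s0 s1]; apply: le_trans (ler_norm_sum _ _ _) _.
  apply: (@le_trans _ _ (\sum_(i < n) `|h| * e')); last first.
    rewrite sumr_const card_ord -mulr_natr mulrC mulrA /e' mulrCA.
    rewrite ler_wpM2l ?(ltW e0) // ler_pdivrMr ?ltr0n // mulrC.
    by rewrite ler_wpM2l // ler_nat.
  apply: ler_sum => i _; rewrite normrM; apply: ler_pM => //.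
    rewrite normrM (ger0_norm t0) -[leRHS]mul1r; apply: ler_pM => //.
    exact: coord_norm_le.
  rewrite scalerA; apply: Hr => //; apply: le_lt_trans hr.
  rewrite normrZ -[leRHS]mul1r ler_wpM2r // normrM !ger0_norm //.
  by rewrite -[leRHS]mul1r; apply: ler_pM.
Qed.

(** Each derivative of a mean is a combination of means of derivatives, so the
induction runs over all weights and all smooth [g] at once. *)
Lemma segment_mean_smooth k g : smooth_on setT g ->
  smooth_on setT (segment_mean y0 k g).
Proof.
move=> + p; elim: p k g => [|p IH] k g sg.
  move=> y _; apply: segment_mean_continuous => x; exact: smooth_on_continuous sg _.
have dg x : differentiable g x by exact: smooth_on_differentiable sg _.
have cdg i : continuous (fun x => 'D_('e_i) g x).
  by move=> x; exact: (smooth_on_continuous (smooth_on_derive 'e_i sg)).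
split; first by move=> y _; have [] := segment_mean_derive k dg cdg y.
move=> v; have H : Ck_on p setT (fun y =>
    \sum_(i < n) v ord0 i * segment_mean y0 k.+1 (fun x => 'D_('e_i) g x) y).
  apply: Ck_on_sum => [|i]; first exact: openT.
  apply: Ck_onM; [exact: openT|exact: Ck_on_cst|].
  by apply: IH; exact: smooth_on_derive.
apply: (Ck_on_eq openT _ H) => y _.
by have [_ ->] := segment_mean_derive k dg cdg y.
Qed.
End SegmentMean.

(** G_i is the mean of 'D_('e_i) F over the segment from y0 to y. *)
Lemma hadamard n (F : 'rV[R]_n -> R) y0 : smooth_on setT F ->
  exists G : 'I_n -> 'rV[R]_n -> R, [/\ forall i, smooth_on setT (G i),
    forall i, G i y0 = 'D_('e_i) F y0 &
    forall y, F y = F y0 + \sum_(i < n) (y ord0 i - y0 ord0 i) * G i y].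
Proof.
move=> sF; exists (fun i => segment_mean y0 0 (fun x => 'D_('e_i) F x)).
have dF x : differentiable F x by exact: smooth_on_differentiable sF _.
have cdF i : continuous (fun x => 'D_('e_i) F x).
  by move=> x; exact: (smooth_on_continuous (smooth_on_derive 'e_i sF)).
have cI i y : continuous (fun t : R => t ^+ 0 * 'D_('e_i) F (y0 + t *: (y - y0))).
  move=> t; apply: cvgM; first exact: cvg_cst.
  apply: (@continuous_comp _ _ _ (fun t : R => y0 + t *: (y - y0)) (fun x => 'D_('e_i) F x)); last exact: cdF.
  by apply: cvgD; [exact: cvg_cst|apply: cvgZr_tmp; exact: cvg_id].
split.
- by move=> i; apply: segment_mean_smooth; exact: smooth_on_derive.
- move=> i; have H := @prim_eq R _ ( *%R^~ ('D_('e_i) F y0)) 1 (cI i y0).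
  apply: (etrans (H _ _)).
  + by rewrite ler01 ltr1n.
  + move=> t _; rewrite expr0 mul1r subrr scaler0 addr0.
    have h2 := is_deriveM (is_derive_id t (1 : R)) (is_derive_cst ('D_('e_i) F y0) t (1 : R)).
    by apply: (trigger_derive h2); rewrite scaler0 add0r -[_ *: _]/(_ * _) mulr1.
  + by rewrite mul1r mul0r subr0.
- move=> y.
  have := @MVT_le R (fun s : R => F (y0 + s *: (y - y0)) - \sum_(i < n) (y ord0 i - y0 ord0 i) *
    prim (fun t : R => t ^+ 0 * 'D_('e_i) F (y0 + t *: (y - y0))) s) (fun=> 0) 1 0.
  rewrite mul0r scale1r scale0r addr0 addrCA subrr addr0.
  rewrite [X in _ - (_ - X)]big1 ?subr0; last by move=> i _; rewrite /= prim0 mulr0.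
  move=> H; suff : `|F y - \sum_(i < n) (y ord0 i - y0 ord0 i) * segment_mean y0 0 (fun x => 'D_('e_i) F x) y - F y0| <= 0.
    by rewrite normr_le0 subr_eq0 => /eqP <-; rewrite subrK.
  apply: H; [by rewrite ler01 ltr1n| |by move=> t _; rewrite normr0].
  move=> t ht.
  have h1 := is_derive_line (dF (y0 + t *: (y - y0))).
  have h2 : is_derive t (1 : R) (fun s => \sum_(i < n) (y ord0 i - y0 ord0 i) *
    prim (fun t : R => t ^+ 0 * 'D_('e_i) F (y0 + t *: (y - y0))) s)
    (\sum_(i < n) (y ord0 i - y0 ord0 i) * (t ^+ 0 * 'D_('e_i) F (y0 + t *: (y - y0)))).
    by apply: is_derive_fsum => i; apply: is_derive_mull; exact: is_derive_prim.
  apply: (trigger_derive (is_deriveB h1 h2)); rewrite derive_rV //.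
  apply/eqP; rewrite subr_eq0; apply/eqP/eq_bigr => i _.
  by rewrite expr0 mul1r !mxE.
Qed.

End Hadamard.

(** * Vector fields in charts *)

Section VectorFieldTheory.
Context {R : realType} {n : nat} {M : manifoldType R n}.
Variable X : vfield M.
Hypothesis hX : is_vfield X.
Implicit Types (f g : M -> R).

Lemma vf_cst (a : R) x : X (fun=> a) x = 0.
Proof.
have s1 := @smooth_fun_cst R n M 1.
have X1 : X (fun=> 1) x = 0.
  have := vf_leibniz hX s1 s1 x.
  rewrite (_ : (fun=> 1 * 1) = fun=> 1); last by apply/funext => y; rewrite mulr1.
  by rewrite !mul1r mulr1 => /eqP; rewrite -subr_eq0 opprD addrA subrr sub0r oppr_eq0 => /eqP.
have := vf_linear hX (a - 1) s1 s1 x; rewrite X1 mulr0 addr0.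
by rewrite (_ : (fun=> (a - 1) * 1 + 1) = fun=> a) //; apply/funext => y; rewrite mulr1 subrK.
Qed.

Lemma vf_D f g x : smooth_fun f -> smooth_fun g ->
  X (fun y => f y + g y) x = X f x + X g x.
Proof.
move=> sf sg; have := vf_linear hX 1 sf sg x; rewrite mul1r => <-.
by congr (X _ x); apply/funext => y; rewrite mul1r.
Qed.

Lemma vf_sum (I : Type) (r : seq I) (f : I -> M -> R) x :
  (forall i, smooth_fun (f i)) ->
  X (fun y => \sum_(i <- r) f i y) x = \sum_(i <- r) X (f i) x.
Proof.
move=> sf; elim: r => [|i r IH].
  rewrite big_nil -[RHS](vf_cst 0 x); congr (X _ x).
  by apply/funext => y; rewrite big_nil.
rewrite big_cons -IH -vf_D //; last exact: smooth_fun_sum.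
by congr (X _ x); apply/funext => y; rewrite big_cons.
Qed.

(** Multiplying by a bump function supported where [f] and [g] agree gives equal
functions; the Leibniz rule then removes the bump. *)
Lemma vf_near f g (x : M) : smooth_fun f -> smooth_fun g ->
  (\forall y \near x, f y = g y) -> X f x = X g x.
Proof.
move=> sf sg fg; have [th [st th1 th0]] := smooth_fun_bump fg.
have Ef h : smooth_fun h -> X (fun y => th y * h y) x = X th x * h x + X h x.
  by move=> sh; rewrite (vf_leibniz hX st sh) (nbhs_singleton th1) mul1r.
have E : (fun y => th y * f y) = (fun y => th y * g y).
  apply/funext => y; have [->//|ne] := pselect (f y = g y).
  by rewrite (th0 y ne) !mul0r.
have := Ef f sf; rewrite E (Ef g sg) (nbhs_singleton fg) => /eqP.
by rewrite (inj_eq (addrI _)) => /eqP.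
Qed.

(** The coefficients are the images under [X] of global extensions of the
coordinates; this makes them smooth functions on the manifold. The formula at
x follows from Hadamard's expansion f = f(x) + sum (c_i - c_i(x)) g_i and the
Leibniz rule. *)
Lemma vf_local_expr c x0 : atlas c -> chart_dom c x0 ->
  exists a : 'I_n -> M -> R, (forall i, smooth_fun (a i)) /\
  \forall x \near x0, chart_dom c x /\ forall f, smooth_fun f ->
    X f x = \sum_(i < n) a i x * 'D_('e_i) (f \o chart_inv c) (c x).
Proof.
move=> ac cx0.
have H i : exists F : M -> R, smooth_fun F /\ \forall x \near x0, F x = (c x) ord0 i.
  have [F [sF nF _]] := smooth_ext ac cx0 (@open_chart_im _ _ _ c) (chart_im_fun cx0)
    (@subset_refl _ _) (smooth_on_linear _ (@coord_linear R n i) (@coord_cts R n i)).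
  by exists F.
have [C HC] := choice H.
exists (fun i => X (C i)); split; first by move=> i; apply: (vf_smooth hX); have [] := HC i.
have near1 : \forall x \near x0, forall i, \forall y \near x, C i y = (c y) ord0 i.
  apply: (@filter_forall _ _ _ (nbhs x0)) => i; have [_] := HC i.
  exact: nbhs_interior.
have near2 : \forall x \near x0, chart_dom c x.
  by apply: open_nbhs_nbhs; split => //; exact: open_chart_dom.
apply: filterS2 near1 near2 => x Hx cx; split => // f sf.
have imx := chart_im_fun cx.
have [F [K [sF nF _ _ _]]] := smooth_ext_rV (@open_chart_im _ _ _ c) imx (sf c ac).
have [G [sG G0 GE]] := hadamard (c x) sF.
have HG i : exists g : M -> R, smooth_fun g /\ \forall y \near x, g y = G i (c y).
  have [g [sg ng _]] := smooth_ext ac cx (@open_chart_im _ _ _ c) imx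
    (@subset_refl _ _) (smooth_onW (@subsetT _ _) (sG i)).
  by exists g.
have [g Hg] := choice HG.
have near3 : \forall y \near x, chart_dom c y.
  by apply: open_nbhs_nbhs; split => //; exact: open_chart_dom.
have near4 : \forall y \near x, F (c y) = (f \o chart_inv c) (c y).
  exact: (chart_fun_continuous cx nF).
have near5 : \forall y \near x, forall i, C i y = (c y) ord0 i.
  by apply: (@filter_forall _ _ _ (nbhs x)) => i; exact: Hx.
have near6 : \forall y \near x, forall i, g i y = G i (c y).
  by apply: (@filter_forall _ _ _ (nbhs x)) => i; have [_] := Hg i.
have sC i : smooth_fun (fun y => C i y + - (c x) ord0 i).
  by apply: smooth_funD; [have [] := HC i|exact: smooth_fun_cst].
have sg i : smooth_fun (g i) by have [] := Hg i.
pose f2 y := f x + \sum_(i < n) (C i y + - (c x) ord0 i) * g i y.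
have sS i : smooth_fun (fun y => (C i y + - (c x) ord0 i) * g i y) by exact: smooth_funM.
have sS2 : smooth_fun (fun y => \sum_(i < n) (C i y + - (c x) ord0 i) * g i y).
  by apply: smooth_fun_sum.
have sf2 : smooth_fun f2 by apply: smooth_funD => //; exact: smooth_fun_cst.
have cxK : (f \o chart_inv c) (c x) = f x by rewrite /= chart_funK.
rewrite (@vf_near f f2 x sf sf2); last first.
  near=> y.
  have cy : chart_dom c y by near: y.
  have -> : f y = F (c y).
    by have : F (c y) = (f \o chart_inv c) (c y) by [near: y]; rewrite /= chart_funK.
  have Cy : forall i, C i y = (c y) ord0 i by near: y.
  have gy : forall i, g i y = G i (c y) by near: y.
  rewrite GE /f2 -cxK (nbhs_singleton nF); congr (_ + _).
  by apply: eq_bigr => i _; rewrite Cy gy.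
rewrite vf_D //; last exact: smooth_fun_cst.
rewrite vf_cst add0r vf_sum //; apply: eq_bigr => i _.
rewrite (vf_leibniz hX (sC i) (sg i)).
rewrite vf_D ?vf_cst ?addr0; [|by have [] := HC i|exact: smooth_fun_cst].
rewrite (nbhs_singleton (Hx i)) subrr mul0r addr0; congr (_ * _).
by rewrite (nbhs_singleton (Hg i).2) G0; exact: near_eq_derive.
Unshelve. all: by end_near. Qed.

End VectorFieldTheory.

(** * Fields acting on separate variables *)

Section Schwarz.
Context {R : realType} {V : normedModType R}.
Implicit Types (F : V -> R) (u v p : V).

Lemma near_parallelogram u v p (Q : set V) : nbhs p Q -> exists2 d : R, 0 < d &
  forall s t : R, 0 <= s <= d -> 0 <= t <= d -> Q (p + s *: u + t *: v).
Proof.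
move=> /nbhs_ballP[r /= r0 rQ].
have k0 : 0 < `|u| + `|v| + 1 by rewrite ltr_wpDl.
exists (r / (`|u| + `|v| + 1)); first by rewrite divr_gt0.
move=> s t /andP[s0 sd] /andP[t0 td]; apply: rQ; rewrite -ball_normE /=.
rewrite -addrA opprD addrA subrr sub0r normrN.
apply: (@le_lt_trans _ _ (r / (`|u| + `|v| + 1) * (`|u| + `|v|))).
  apply: le_trans (ler_normD _ _) _; rewrite !normrZ !ger0_norm // mulrDr.
  by apply: lerD; apply: ler_wpM2r.
by rewrite mulrAC ltr_pdivrMr // ltr_pM2l // ltrDl.
Qed.

(** The mean value theorem in direction u, then in direction v. *)
Lemma second_difference F (U : set V) u v p : open U -> U p -> smooth_on U F ->
  forall e, 0 < e -> exists2 d : R, 0 < d & forall h : R, 0 < h <= d ->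
  `|(F (p + h *: u + h *: v) - F (p + h *: u) - (F (p + h *: v) - F p)) -
    h * h * 'D_v (fun x => 'D_u F x) p| <= e * (h * h).
Proof.
move=> oU Up sF e e0.
have sDF := smooth_on_derive u sF.
have cD := smooth_on_continuous (smooth_on_derive v sDF) Up.
have near1 : \forall x \near p, U x /\
    `|'D_v (fun x => 'D_u F x) p - 'D_v (fun x => 'D_u F x) x| <= e.
  apply: filterI; first by apply: open_nbhs_nbhs; split.
  by move/cvgrPdist_le: cD => /(_ _ e0).
have [d d0 Hd] := near_parallelogram u v near1.
exists d => // h /andP[h0 hd].
have in0h (s : R) : s \in `[0, h] -> 0 <= s <= d.
  by rewrite in_itv /= => /andP[-> sh]; exact: le_trans hd.
have hh : 0 <= h <= d by rewrite ltW.
have d00 : 0 <= (0 : R) <= d by rewrite lexx ltW.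
have dF x : U x -> differentiable F x by move=> Ux; exact: smooth_on_differentiable sF Ux.
have dDF x : U x -> differentiable (fun x => 'D_u F x) x.
  by move=> Ux; exact: smooth_on_differentiable sDF Ux.
pose g (s : R) := F (p + h *: v + s *: u) - F (p + s *: u).
have dg (s : R) : s \in `[0, h] -> is_derive s (1 : R) g
    ('D_u F (p + h *: v + s *: u) - 'D_u F (p + s *: u)).
  move=> /in0h hs; apply: is_deriveB; apply: is_derive_line; apply: dF.
    by rewrite addrAC; exact: (Hd s h hs hh).1.
  by have := (Hd s 0 hs d00).1; rewrite scale0r addr0.
have [c c0h] := MVT0 (ltW h0) dg.
rewrite /g !scale0r !addr0 => E1.
pose k (t : R) := 'D_u F (p + c *: u + t *: v).
have dk (t : R) : t \in `[0, h] -> is_derive t (1 : R) k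
    ('D_v (fun x => 'D_u F x) (p + c *: u + t *: v)).
  move=> /in0h ht; apply: is_derive_line; apply: dDF.
  exact: (Hd c t (in0h _ c0h) ht).1.
have [c' c0h'] := MVT0 (ltW h0) dk.
rewrite /k !scale0r !addr0 => E2.
have -> : F (p + h *: u + h *: v) - F (p + h *: u) - (F (p + h *: v) - F p) =
   h * h * 'D_v (fun x => 'D_u F x) (p + c *: u + c' *: v).
  rewrite -[RHS]mulrA [h * 'D_v _ _]mulrC -E2 mulrC.
  rewrite [p + c *: u + h *: v]addrAC -E1 [p + h *: v + _]addrAC; ring.
rewrite -mulrBr normrM ger0_norm ?mulr_ge0 ?(ltW h0) // mulrC ler_wpM2r ?mulr_ge0 ?(ltW h0) //.
by rewrite distrC; exact: (Hd c c' (in0h _ c0h) (in0h _ c0h')).2.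
Qed.

(** The second difference is symmetric in [u] and [v], and both mixed derivatives
are its limit after division by h^2. *)
Lemma derive_swap F (U : set V) u v p : open U -> U p -> smooth_on U F ->
  'D_u (fun x => 'D_v F x) p = 'D_v (fun x => 'D_u F x) p.
Proof.
move=> oU Up sF; apply/eqP; rewrite -subr_eq0 -normr_le0.
apply/ler_addgt0Pl => e e0; rewrite addr0.
have e20 : 0 < e / 2 by rewrite divr_gt0.
have [d1 d10 H1] := second_difference u v oU Up sF e20.
have [d2 d20 H2] := second_difference v u oU Up sF e20.
pose h := Num.min d1 d2.
have h0 : 0 < h by rewrite lt_min d10.
have := H1 h; rewrite h0 ge_min lexx => /(_ isT).
have := H2 h; rewrite h0 ge_min lexx orbT => /(_ isT).
rewrite [p + h *: v + _]addrAC.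
set A := _ - _ - (_ - _); set A' := _ - _ - (_ - _).
have -> : A = A' by rewrite /A /A'; ring.
set a := derive _ _ _; set b := derive _ _ _ => h2 h1.
have hh : 0 < h * h by rewrite mulr_gt0.
rewrite -(ler_pM2r hh) -[X in _ * X <= _]ger0_norm ?(ltW hh) // -normrM.
have -> : (a - b) * (h * h) = (A' - h * h * b) - (A' - h * h * a) by ring.
apply: le_trans (ler_normB _ _) _; rewrite [e in leRHS]splitr mulrDl.
exact: (lerD h1 h2).
Qed.

End Schwarz.

Section PartialDerivatives.
Context {R : realType} {V W : normedModType R}.
Variables (F : V * W -> R) (x : V) (y : W).

Let right_rate w :
  (fun h : R => h^-1 *: (((fun z => F (x, z)) \o shift y) (h *: w) - F (x, y))) =
  (fun h : R => h^-1 *: ((F \o shift (x, y)) (h *: ((0 : V), w)) - F (x, y))).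
Proof.
apply/funext => h; congr (_ *: (F (_, _) - _)).
by rewrite /= scaler0 add0r.
Qed.

Let left_rate v :
  (fun h : R => h^-1 *: (((fun z => F (z, y)) \o shift x) (h *: v) - F (x, y))) =
  (fun h : R => h^-1 *: ((F \o shift (x, y)) (h *: (v, (0 : W))) - F (x, y))).
Proof.
apply/funext => h; congr (_ *: (F (_, _) - _)).
by rewrite /= scaler0 add0r.
Qed.

Lemma derive_right w : 'D_w (fun z => F (x, z)) y = 'D_((0 : V), w) F (x, y).
Proof. by rewrite /derive right_rate. Qed.

Lemma derive_left v : 'D_v (fun z => F (z, y)) x = 'D_(v, (0 : W)) F (x, y).
Proof. by rewrite /derive left_rate. Qed.

Lemma is_derive_right w : differentiable F (x, y) ->
  is_derive y w (fun z => F (x, z)) ('D_((0 : V), w) F (x, y)).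
Proof.
move=> /(@diff_derivable _ _ _ F _ ((0 : V), w)) dF; split; last exact: derive_right.
by rewrite /derivable right_rate.
Qed.

Lemma is_derive_left v : differentiable F (x, y) ->
  is_derive x v (fun z => F (z, y)) ('D_(v, (0 : W)) F (x, y)).
Proof.
move=> /(@diff_derivable _ _ _ F _ (v, (0 : W))) dF; split; last exact: derive_left.
by rewrite /derivable left_rate.
Qed.

End PartialDerivatives.

Section TwoVariables.
Context {R : realType} {n p : nat} {M : manifoldType R n} {N : manifoldType R p}.

(** Smoothness on the product manifold, for a curried function, so that a field
can act on either variable. *)
Definition smooth_fun2 (Psi : M -> N -> R) : Prop :=
  forall (c1 : chart R n M) (c2 : chart R p N), atlas c1 -> atlas c2 ->
    smooth_on [set y : 'rV[R]_n * 'rV[R]_p | chart_im c1 y.1 /\ chart_im c2 y.2]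
      (fun y => Psi (chart_inv c1 y.1) (chart_inv c2 y.2)).

Lemma open_chart_im2 (c1 : chart R n M) (c2 : chart R p N) (A : set 'rV[R]_p) :
  open A ->
  open [set y : 'rV[R]_n * 'rV[R]_p | chart_im c1 y.1 /\ A y.2].
Proof.
move=> oA; have o1 : open (chart_im c1) by exact: open_chart_im.
rewrite openE => -[y1 y2] [/= h1 h2]; exists (chart_im c1, A) => //=.
by split; apply: open_nbhs_nbhs.
Qed.

Lemma smooth_fun2_left (Psi : M -> N -> R) (z : N) : smooth_fun2 Psi ->
  smooth_fun (fun x => Psi x z).
Proof.
move=> sP c1 a1; have [c2 a2 c2z] := atlas_cover z.
have sL : smooth_on (chart_im c1) (fun y => (y, 0 : 'rV[R]_p) + (0 : 'rV[R]_n, c2 z)).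
  apply: smooth_onD; [exact: open_chart_im| |exact: smooth_on_cst].
  apply: smooth_on_linear; first by move=> a x y; congr pair; rewrite /= scaler0 addr0.
  by move=> y; apply: (@cvg_pair _ _ _ (nbhs y) (nbhs y) (nbhs (0 : 'rV[R]_p))); [exact: cvg_id|exact: cvg_cst].
have H := smooth_on_comp (has_coords_prod (has_coords_rV n) (has_coords_rV p))
  (@open_chart_im _ _ _ c1) _ sL (sP c1 c2 a1 a2).
apply: (smooth_on_eq (@open_chart_im _ _ _ c1) _ (H _)) => y yc.
  by rewrite /= add0r chart_funK // addr0.
by split => /=; rewrite ?addr0 ?add0r //; exact: chart_im_fun.
Qed.

Lemma smooth_fun2_right (Psi : M -> N -> R) (x : M) : smooth_fun2 Psi ->
  smooth_fun (Psi x).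
Proof.
move=> sP c2 a2; have [c1 a1 c1x] := atlas_cover x.
have sL : smooth_on (chart_im c2) (fun y => (0 : 'rV[R]_n, y) + (c1 x, 0 : 'rV[R]_p)).
  apply: smooth_onD; [exact: open_chart_im| |exact: smooth_on_cst].
  apply: smooth_on_linear; first by move=> a y z; congr pair; rewrite /= scaler0 addr0.
  by move=> y; apply: (@cvg_pair _ _ _ (nbhs y) (nbhs (0 : 'rV[R]_n)) (nbhs y)); [exact: cvg_cst|exact: cvg_id].
have H := smooth_on_comp (has_coords_prod (has_coords_rV n) (has_coords_rV p))
  (@open_chart_im _ _ _ c2) _ sL (sP c1 c2 a1 a2).
apply: (smooth_on_eq (@open_chart_im _ _ _ c2) _ (H _)) => y yc.
  by rewrite /= add0r chart_funK // addr0.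
by split => /=; rewrite ?addr0 ?add0r //; exact: chart_im_fun.
Qed.

(** In charts, [Y] acting on the second variable is a combination of partial
derivatives with smooth coefficients. *)
Lemma smooth_fun2_vf (Y : vfield N) (Psi : M -> N -> R) : is_vfield Y ->
  smooth_fun2 Psi -> smooth_fun2 (fun x => Y (Psi x)).
Proof.
move=> hY sP c1 c2 a1 a2; apply: smooth_on_local => -[y1 y2] [/= im1 im2].
have [dz dzy] := chart_imP im2.
have [a [sa nearz]] := vf_local_expr hY a2 dz.
move: nearz; rewrite /prop_near1 nbhsE => -[A [oA Az] HA].
pose B := [set y | chart_im c2 y /\ A (chart_inv c2 y)].
have oB : open B by exact: open_chart_preim.
have oE := @open_chart_im2 c1 c2 B oB.
exists [set y : 'rV[R]_n * 'rV[R]_p | chart_im c1 y.1 /\ B y.2] => //.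
pose F (y : 'rV[R]_n * 'rV[R]_p) := Psi (chart_inv c1 y.1) (chart_inv c2 y.2).
have sF : smooth_on [set y : 'rV[R]_n * 'rV[R]_p | chart_im c1 y.1 /\ B y.2] F.
  by apply: (smooth_onW _ (sP c1 c2 a1 a2)) => y [h1 [h2 _]].
have H : smooth_on [set y : 'rV[R]_n * 'rV[R]_p | chart_im c1 y.1 /\ B y.2]
   (fun y => \sum_(i < p) (a i \o chart_inv c2 \o snd) y * 'D_(0, 'e_i) F y).
  apply: smooth_on_sum => // i; apply: smooth_onM => //; last exact: smooth_on_derive.
  apply: (@smooth_on_comp _ _ _ _ (chart_im c2) snd (a i \o chart_inv c2)) => //.
  - exact: has_coords_rV.
  - by move=> y [_ []].
  - by apply: smooth_on_linear => // x; exact: cvg_snd.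
  - exact: sa.
apply: (smooth_on_eq oE _ H) => -[z1 z2] [/= i1 [i2 Bz]].
have [_ E] := HA _ Bz.
rewrite E; last exact: smooth_fun2_right.
apply: eq_bigr => i _; congr (_ * _).
by have [_ ->] := chart_imP i2; rewrite -derive_right.
Qed.

End TwoVariables.

Section TwoVariablesSwap.
Context {R : realType} {n p : nat} {M : manifoldType R n} {N : manifoldType R p}.

Lemma smooth_fun2_swap (Psi : M -> N -> R) : smooth_fun2 Psi ->
  smooth_fun2 (fun z x => Psi x z).
Proof.
move=> sP c2 c1 a2 a1.
have oE := @open_chart_im2 _ _ _ _ _ c2 c1 _ (@open_chart_im _ _ _ c1).
apply: (@smooth_on_comp _ _ _ _ [set y | chart_im c1 y.1 /\ chart_im c2 y.2]
  (fun y : 'rV[R]_p * 'rV[R]_n => (y.2, y.1))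
  (fun y => Psi (chart_inv c1 y.1) (chart_inv c2 y.2))) => //.
- exact: has_coords_prod (has_coords_rV n) (has_coords_rV p).
- by move=> y [].
- apply: smooth_on_linear => // y.
  by apply: (@cvg_pair _ _ _ (nbhs y) (nbhs y.2) (nbhs y.1)); [exact: cvg_snd|exact: cvg_fst].
- exact: sP.
Qed.

(** In charts this is the symmetry of second derivatives, the coefficients of
each field being constant for the other one. *)
Lemma vf_swap (X : vfield M) (Y : vfield N) (Psi : M -> N -> R) x z :
  is_vfield X -> is_vfield Y -> smooth_fun2 Psi ->
  X (fun x' => Y (Psi x') z) x = Y (fun z' => X (fun x' => Psi x' z') x) z.
Proof.
move=> hX hY sP.
have [c1 a1 c1x] := atlas_cover x; have [c2 a2 c2z] := atlas_cover z.
have [a [_ /nbhs_singleton [_ Ea]]] := vf_local_expr hX a1 c1x.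
have [b [_ /nbhs_singleton [_ Eb]]] := vf_local_expr hY a2 c2z.
pose F (y : 'rV[R]_n * 'rV[R]_p) := Psi (chart_inv c1 y.1) (chart_inv c2 y.2).
have sF := sP c1 c2 a1 a2; rewrite -/F in sF.
have oE := @open_chart_im2 _ _ _ _ _ c1 c2 _ (@open_chart_im _ _ _ c2).
have Ep : [set y : 'rV[R]_n * 'rV[R]_p | chart_im c1 y.1 /\ chart_im c2 y.2] (c1 x, c2 z).
  by split; exact: chart_im_fun.
rewrite Ea; last exact: smooth_fun2_left (smooth_fun2_vf hY sP).
rewrite Eb; last first.
  exact: smooth_fun2_left (smooth_fun2_vf hX (smooth_fun2_swap sP)).
have dD w : differentiable (fun y => 'D_w F y) (c1 x, c2 z).
  exact: smooth_on_differentiable (smooth_on_derive w sF) Ep.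
have El (i : 'I_n) : 'D_('e_i) ((fun x' => Y (Psi x') z) \o chart_inv c1) (c1 x) =
    \sum_(j < p) b j z * 'D_('e_i, 0) (fun y => 'D_(0, 'e_j) F y) (c1 x, c2 z).
  rewrite (_ : _ \o _ = (fun y => \sum_(j < p) b j z * 'D_(0, 'e_j) F (y, c2 z))); last first.
    apply/funext => y /=; rewrite Eb; last exact: smooth_fun2_right.
    by apply: eq_bigr => j _; rewrite -derive_right.
  have d := @is_derive_fsum R _ p (fun j y => b j z * 'D_(0, 'e_j) F (y, c2 z)) (c1 x) 'e_i _
    (fun j => is_derive_mull (b j z) (is_derive_left 'e_i (dD (0, 'e_j)))).
  by rewrite derive_val.
have Er (j : 'I_p) : 'D_('e_j) ((fun z' => X (fun x' => Psi x' z') x) \o chart_inv c2) (c2 z) =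
    \sum_(i < n) a i x * 'D_(0, 'e_j) (fun y => 'D_('e_i, 0) F y) (c1 x, c2 z).
  rewrite (_ : _ \o _ = (fun y => \sum_(i < n) a i x * 'D_('e_i, 0) F (c1 x, y))); last first.
    apply/funext => y /=; rewrite Ea; last exact: smooth_fun2_left.
    by apply: eq_bigr => i _; rewrite -derive_left.
  have d := @is_derive_fsum R _ n (fun i y => a i x * 'D_('e_i, 0) F (c1 x, y)) (c2 z) 'e_j _
    (fun i => is_derive_mull (a i x) (is_derive_right 'e_j (dD ('e_i, 0)))).
  by rewrite derive_val.
under eq_bigr do rewrite El mulr_sumr.
under [RHS]eq_bigr do rewrite Er mulr_sumr.
rewrite exchange_big /=; apply: eq_bigr => j _; apply: eq_bigr => i _.
have E := derive_swap ('e_i, 0) (0, 'e_j) oE Ep sF.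
rewrite [in LHS]E.
exact: mulrCA.
Qed.
End TwoVariablesSwap.

(** * Curves in a Lie group *)

Section WithinContinuity.
Context {T U1 U2 W : topologicalType}.

Lemma within_continuous_pair (A : set T) (u : T -> U1) (w : T -> U2)
    (Phi : U1 * U2 -> W) : {within A, continuous u} ->
  {within A, continuous w} -> continuous Phi ->
  {within A, continuous (fun t => Phi (u t, w t))}.
Proof.
move=> /subspace_continuousP cu /subspace_continuousP cw cPhi.
apply/subspace_continuousP => x Ax.
apply: (cvg_comp (fun t => (u t, w t)) Phi _ (cPhi _)).
by apply: cvg_pair; [exact: cu|exact: cw].
Qed.

Lemma within_continuous_post (A : set T) (u : T -> U1) (Phi : U1 -> W) :
  {within A, continuous u} -> continuous Phi ->
  {within A, continuous (fun t => Phi (u t))}.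
Proof.
move=> /subspace_continuousP cu cPhi; apply/subspace_continuousP => x Ax.
exact: (cvg_comp u Phi (cu x Ax) (cPhi _)).
Qed.

Lemma within_continuous_interior (A : set T) (u : T -> U1) (x : T) :
  {within A, continuous u} -> nbhs x A -> {for x, continuous u}.
Proof.
move=> /subspace_continuousP cu Ax; have := cu x (nbhs_singleton Ax).
by rewrite within_interior.
Qed.

Lemma for_continuous_pair (u : T -> U1) (w : T -> U2) (x : T) :
  {for x, continuous u} -> {for x, continuous w} ->
  {for x, continuous (fun t => (u t, w t))}.
Proof.
by move=> cu cw; apply: (@cvg_pair _ _ _ (nbhs x) (nbhs (u x)) (nbhs (w x))).
Qed.

Lemma for_continuous_fst (u : T -> W) (x : T) (z : U1) : {for x, continuous u} ->
  {for (x, z), continuous (fun p : T * U1 => u p.1)}.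
Proof. by move=> cu; exact: (cvg_comp fst u cvg_fst cu). Qed.

Lemma for_continuous_snd (u : T -> W) (x : T) (z : U1) : {for x, continuous u} ->
  {for (z, x), continuous (fun p : U1 * T => u p.2)}.
Proof. by move=> cu; exact: (cvg_comp snd u cvg_snd cu). Qed.

Lemma for_continuous_comp (u : T -> U1) (w : U1 -> W) (x : T) :
  {for x, continuous u} -> {for u x, continuous w} ->
  {for x, continuous (fun t => w (u t))}.
Proof. by move=> cu cw; exact: (cvg_comp u w cu cw). Qed.

End WithinContinuity.

Section IntegralCurve.
Context {R : realType} {n : nat} {M : manifoldType R n}.

(** The equation is required in the interior only and continuity up to the
endpoints, which is stable under gluing and translation in time. *)
Definition curve_of (X : vfield M) (a b : R) (v : R -> M) : Prop :=
  {within `[a, b], continuous v} /\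
  forall s : R, s \in `]a, b[ -> forall f, smooth_fun f ->
    is_derive s (1 : R) (fun r => f (v r)) (X f (v s)).

End IntegralCurve.

Section SmoothMaps.
Context {R : realType} {n p q : nat}.
Context {M : manifoldType R n} {N : manifoldType R p} {L : manifoldType R q}.

Lemma smooth_fun_comp (F : M -> N) (f : N -> R) : smooth_map F -> smooth_fun f ->
  smooth_fun (fun x => f (F x)).
Proof.
move=> [cF sF] sf; apply: smooth_fun_local => x.
have [c ac cx] := atlas_cover x; have [d ad dx] := atlas_cover (F x).
exists c; split => //.
have oA : open (F @^-1` chart_dom d).
  by apply: (open_comp (fun x _ => cF x)); exact: open_chart_dom.
pose B := [set y | chart_im c y /\ (F @^-1` chart_dom d) (chart_inv c y)].
have oB : open B by exact: open_chart_preim.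
exists B; split => //.
- by split; [exact: chart_im_fun|rewrite /= chart_funK].
- by move=> y [].
have sFB : smooth_on B (d \o F \o chart_inv c).
  apply: (smooth_onW _ (sF c d ac ad)) => y [ic Fy].
  by have [h1 h2] := chart_imP ic; exists (chart_inv c y).
have H := smooth_on_comp (has_coords_rV p) oB _ sFB (sf d ad).
apply: (smooth_on_eq oB _ (H _)) => y [ic Fy] /=; first by rewrite chart_funK.
exact: chart_im_fun.
Qed.

Lemma smooth_fun2_comp (F : M * N -> L) (f : L -> R) : smooth_map2 F ->
  smooth_fun f -> smooth_fun2 (fun x y => f (F (x, y))).
Proof.
move=> [cF sF] sf c1 c2 a1 a2; apply: smooth_on_local => -[y1 y2] [/= i1 i2].
have [d ad dz] := atlas_cover (F (chart_inv c1 y1, chart_inv c2 y2)).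
pose E := [set y : 'rV[R]_n * 'rV[R]_p |
   [/\ chart_im c1 y.1, chart_im c2 y.2 &
       chart_dom d (F (chart_inv c1 y.1, chart_inv c2 y.2))]].
have oE : open E.
  rewrite openE => -[z1 z2] [/= h1 h2 h3]; rewrite /interior.
  have H1 : nbhs (z1, z2) [set y : 'rV[R]_n * 'rV[R]_p | chart_im c1 y.1 /\ chart_im c2 y.2].
    apply: open_nbhs_nbhs; split => //.
    exact: (@open_chart_im2 _ _ _ _ _ c1 c2 _ (@open_chart_im _ _ _ c2)).
  have H2 : (F (chart_inv c1 y.1, chart_inv c2 y.2)) @[y --> (z1, z2)] -->
      F (chart_inv c1 z1, chart_inv c2 z2).
    have k1 := @for_continuous_fst _ _ _ _ _ z2 (chart_inv_continuous h1).
    have k2 := @for_continuous_snd _ _ _ _ _ z1 (chart_inv_continuous h2).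
    exact: (for_continuous_comp (for_continuous_pair k1 k2) (cF _)).
  have H3 := H2 _ (open_nbhs_nbhs (conj (open_chart_dom d) h3)).
  by apply: filterS2 H1 H3 => y [].
exists E => //.
have H := smooth_on_comp (has_coords_rV q) oE _ (sF c1 c2 d a1 a2 ad) (sf d ad).
apply: (smooth_on_eq oE _ (H _)) => -[z1 z2] [/= h1 h2 h3]; first by rewrite chart_funK.
exact: chart_im_fun.
Qed.

Lemma smooth_fun2_continuous (Psi : M -> N -> R) : smooth_fun2 Psi ->
  continuous (fun y : M * N => Psi y.1 y.2).
Proof.
move=> sP -[x z].
have [c1 a1 c1x] := atlas_cover x; have [c2 a2 c2z] := atlas_cover z.
have Ep : [set y : 'rV[R]_n * 'rV[R]_p | chart_im c1 y.1 /\ chart_im c2 y.2] (c1 x, c2 z).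
  by split; exact: chart_im_fun.
have cP := smooth_on_continuous (sP c1 c2 a1 a2) Ep.
have H : (Psi (chart_inv c1 (c1 y.1)) (chart_inv c2 (c2 y.2))) @[y --> (x, z)] --> Psi x z.
  have : {for (x, z), continuous ((fun y => Psi (chart_inv c1 y.1) (chart_inv c2 y.2)) \o
     (fun y : M * N => (c1 y.1, c2 y.2)))}.
    have k1 := @for_continuous_fst _ _ _ _ _ z (chart_fun_continuous c1x).
    have k2 := @for_continuous_snd _ _ _ _ _ x (chart_fun_continuous c2z).
    exact: (for_continuous_comp (for_continuous_pair k1 k2) cP).
  by rewrite /prop_for /continuous_at /= !chart_funK.
apply: cvg_trans H; apply: near_eq_cvg.
have n1 := open_nbhs_nbhs (conj (open_chart_dom c1) c1x).
have n2 := open_nbhs_nbhs (conj (open_chart_dom c2) c2z).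
exists (chart_dom c1, chart_dom c2) => // -[y1 y2] [/= h1 h2].
by rewrite !chart_funK.
Qed.

End SmoothMaps.

Section DiagonalDerivative.
Context {R : realType}.

Lemma MVT_line (G g : R -> R) (s0 h : R) :
  (forall t, `|t - s0| <= `|h| -> is_derive t (1 : R) G (g t)) ->
  exists2 c, `|c - s0| <= `|h| & G (s0 + h) - G s0 = g c * h.
Proof.
move=> dG.
have near_s0 (s : R) : s \in `[0, 1] -> `|s0 + s * h - s0| <= `|h|.
  rewrite in_itv /= => /andP[sge sle].
  by rewrite addrAC subrr add0r normrM ger0_norm // ler_piMl.
have [|c c01] := @MVT0 R (fun s => G (s0 + s * h)) (fun s => g (s0 + s * h) * h) 1 ler01.
  move=> s /near_s0 /dG ds.
  have dl : is_derive s (1 : R) (fun s : R => s0 + s * h) h.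
    have dm := is_deriveM (is_derive_id s (1 : R)) (is_derive_cst h s (1 : R)).
    have := is_deriveD (is_derive_cst s0 s (1 : R)) dm; move=> da.
    by apply: (trigger_derive da); rewrite scaler0 !add0r -[_ *: _]/(_ * _) mulr1.
  exact: (@is_derive1_comp _ G (fun s : R => s0 + s * h) s).
rewrite mul1r mul0r addr0 mulr1 => E; exists (s0 + c * h) => //; exact: near_s0.
Qed.

(** The product rule in a form where only the second partial derivative has to be
known near the diagonal and continuous at the point: the increment in the second
variable is evaluated by the mean value theorem. *)
Lemma is_derive_diag (H : R -> R -> R) (B : R * R -> R) (s0 a : R) :
  is_derive s0 (1 : R) (fun s => H s s0) a ->
  (\forall z \near (s0, s0), is_derive z.2 (1 : R) (H z.1) (B z)) ->
  {for (s0, s0), continuous B} ->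
  is_derive s0 (1 : R) (fun s => H s s) (a + B (s0, s0)).
Proof.
move=> /is_derive1P Ha HB cB; apply/is_derive1P => e e0.
have e20 : 0 < e / 2 by rewrite divr_gt0.
have near1 := Ha _ e20.
have near2 : \forall z \near (s0, s0), is_derive z.2 (1 : R) (H z.1) (B z) /\
    `|B (s0, s0) - B z| <= e / 2.
  by apply: filterI => //; move/cvgrPdist_le: cB => /(_ _ e20).
have /nbhs_ballP[r /= r0 Hr] := near2.
have near3 : \forall h \near (0 : R), `|h| < r.
  by apply/nbhs_ballP; exists r => // h; rewrite -ball_normE /= sub0r normrN.
apply: filterS2 near1 near3 => h h1 hr.
have ball_h (t : R) : `|t - s0| <= `|h| -> ball (s0, s0) r (s0 + h, t).
  move=> th; split; rewrite -ball_normE /=; last by rewrite distrC (le_lt_trans th).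
  by rewrite opprD addrA subrr sub0r normrN.
have [c hc E] := @MVT_line (H (s0 + h)) (fun t => B (s0 + h, t)) s0 h
  (fun t ht => (Hr _ (ball_h t ht)).1).
have hB := (Hr _ (ball_h c hc)).2.
have -> : H (s0 + h) (s0 + h) - H s0 s0 - h * (a + B (s0, s0)) =
  (H (s0 + h) s0 - H s0 s0 - h * a) + h * (B (s0 + h, c) - B (s0, s0)).
  rewrite mulrBr [h * B (s0 + h, c)]mulrC -E; ring.
apply: le_trans (ler_normD _ _) _; rewrite [e]splitr mulrDl; apply: lerD => //.
by rewrite normrM mulrC ler_wpM2r // distrC.
Qed.

End DiagonalDerivative.

Section LieGroup.
Context {R : realType} {n : nat} {G : lieGroupType R n}.
Implicit Types (f : G -> R) (X V : vfield G).

Lemma smooth_mul2 f : smooth_fun f -> smooth_fun2 (fun x y : G => f (x * y)%g).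
Proof. by move=> sf; exact: smooth_fun2_comp mulg_smooth sf. Qed.

Lemma smooth_lmul f (g : G) : smooth_fun f -> smooth_fun (fun x => f (g * x)%g).
Proof. by move=> /smooth_mul2; exact: smooth_fun2_right. Qed.

Lemma smooth_rmul f (g : G) : smooth_fun f -> smooth_fun (fun x => f (x * g)%g).
Proof. by move=> /smooth_mul2; exact: smooth_fun2_left. Qed.

Lemma smooth_inv f : smooth_fun f -> smooth_fun (fun x : G => f (x^-1)%g).
Proof. by move=> sf; exact: smooth_fun_comp invg_smooth sf. Qed.

Lemma mulg_continuous : continuous (fun x : G * G => (x.1 * x.2)%g).
Proof. by have [] := @mulg_smooth R n G. Qed.

Lemma invg_continuous : continuous (fun x : G => x^-1%g).
Proof. by have [] := @invg_smooth R n G. Qed.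

Lemma for_continuous_mulg (T : topologicalType) (u w : T -> G) (x : T) :
  {for x, continuous u} -> {for x, continuous w} ->
  {for x, continuous (fun t => (u t * w t)%g)}.
Proof.
move=> cu cw; have k := for_continuous_pair cu cw.
exact: (for_continuous_comp k (@mulg_continuous (u x, w x))).
Qed.

Lemma within_continuous_mulg (T : topologicalType) (A : set T) (u w : T -> G) :
  {within A, continuous u} -> {within A, continuous w} ->
  {within A, continuous (fun t => (u t * w t)%g)}.
Proof. by move=> cu cw; exact: (within_continuous_pair cu cw mulg_continuous). Qed.

Lemma dI_vfield X : is_vfield X -> is_vfield (dI X).
Proof.
move=> hX; split.
- by move=> f sf; apply: smooth_inv; apply: (vf_smooth hX); exact: smooth_inv.
- by move=> a f g sf sg x; apply: (vf_linear hX); exact: smooth_inv.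
- by move=> f g sf sg x; rewrite /dI (vf_leibniz hX) ?invgK //; exact: smooth_inv.
Qed.

(** Inversion exchanges left and right translations. *)
Lemma dI_left_invariant X f (g x : G) : right_invariant X -> smooth_fun f ->
  dI X (fun y => f (g * y)%g) x = dI X f (g * x)%g.
Proof.
move=> [_ rX] sf; rewrite /dI invgM -(rX _ _ (smooth_inv sf)).
by congr (X _ _); apply/funext => y; rewrite invgM invgK.
Qed.

(** With K x z = V (f \o L_x) z, the function Phi(r) = K (v r) ((v r)^-1 y) is
constant; comparing its values at 0 and s gives the claim. In Phi'(r) the
first variable contributes dI X (f (x z)) taken along x, which commutes with V and
equals - X (f (x z)) taken along z, because both are computed from the
derivatives at 1, where dI X = - X. This gives - V X, the second variable gives
X V, and the sum vanishes as [X, V] = 0. *)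
Lemma curve_of_left_invariant X V (b : R) (v : R -> G) :
  right_invariant X -> right_invariant V -> vf_eq (vf_bracket X V) (@vf0 R n G) ->
  (forall f, smooth_fun f -> dI X f 1%g = - X f 1%g) ->
  curve_of (dI X) 0 b v -> v 0 = 1%g ->
  forall s : R, s \in `[0, b] -> forall f, smooth_fun f -> forall y,
    V (fun x => f (v s * x)%g) y = V f (v s * y)%g.
Proof.
move=> [hX rX] [hV rV] XV Xe [cv dv] v0 s s0b f sf y0.
suff H y : V (fun x => f (v s * x)%g) ((v s)^-1 * y)%g = V f y.
  by rewrite -H mulKg.
have hZ := dI_vfield hX.
pose K (x z : G) := V (fun w => f (x * w)%g) z.
have sK : smooth_fun2 K by apply: smooth_fun2_vf => //; exact: smooth_mul2.
have sXK : smooth_fun2 (fun x z => X (K x) z) by exact: smooth_fun2_vf.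
pose Phi r := K (v r) ((v r)^-1 * y)%g.
have cw : continuous (fun x : G => (x^-1 * y)%g).
  move=> x; have k : {for x, continuous (fun _ : G => y)} by exact: cvg_cst.
  exact: (for_continuous_mulg (@invg_continuous x) k).
have cPhi : {within `[0, b], continuous Phi}.
  exact: (within_continuous_pair cv (within_continuous_post cv cw)
    (smooth_fun2_continuous sK)).
have dPhi (r : R) : r \in `]0, b[ -> is_derive r (1 : R) Phi 0.
  move=> r0b; pose z0 := ((v r)^-1 * y)%g.
  have dl : is_derive r (1 : R) (fun t => K (v t) z0) (dI X (fun x => K x z0) (v r)).
    by apply: (dv _ r0b); exact: smooth_fun2_left.
  have dr (x : G) (t : R) : t \in `]0, b[ ->
      is_derive t (1 : R) (fun t => K x ((v t)^-1 * y)%g) (X (K x) ((v t)^-1 * y)%g).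
    move=> t0b; have sKx := smooth_fun2_right x sK.
    have sKxy := smooth_rmul y sKx.
    have := dv _ t0b _ (smooth_inv sKxy); rewrite /dI -rX //.
    by congr (is_derive _ _ _ (X _ _)); apply/funext => w; rewrite invgK.
  have r0b_near : \forall t \near r, t \in `]0, b[ by exact: near_in_itvoo.
  have cvr : {for r, continuous v}.
    apply: (within_continuous_interior cv).
    by apply: filterS r0b_near => t; exact: subset_itv_oo_cc.
  have -> : 0 = dI X (fun x => K x z0) (v r) + X (K (v r)) z0 :> R.
    rewrite (vf_swap _ _ hZ hV (smooth_mul2 sf)).
    have -> : (fun z => dI X (fun x => f (x * z)%g) (v r)) =
              (fun z => - X (fun w => f (v r * w)%g) z).
      apply/funext => z; have sfz := smooth_rmul z sf.
      rewrite -{1}[v r]mulg1 -(dI_left_invariant _ _ (conj hX rX) sfz).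
      have sfz' := smooth_lmul (v r) sfz.
      rewrite Xe // -{2}[z]mul1g -rX; last exact: smooth_lmul.
      by congr (- X _ _); apply/funext => w; rewrite mulgA.
    have sg := smooth_lmul (v r) sf.
    have sXg := vf_smooth hX sg.
    have := vf_linear hV (-1) sXg (@smooth_fun_cst _ _ G 0) z0.
    rewrite vf_cst // addr0 => E.
    have -> : (fun z => - X (fun w => f (v r * w)%g) z) =
       (fun z => - 1 * X (fun w => f (v r * w)%g) z + 0).
      by apply/funext => z; rewrite addr0 mulN1r.
    rewrite E mulN1r; have := XV _ sg z0; rewrite /vf_bracket /vf0 => /eqP.
    by rewrite subr_eq0 => /eqP <-; rewrite addrC subrr.
  apply: (@is_derive_diag R (fun s t => K (v s) ((v t)^-1 * y)%g)
    (fun p => X (K (v p.1)) ((v p.2)^-1 * y)%g)) => //.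
    exists ([set t | t \in `]0, b[], [set t | t \in `]0, b[]); first by split.
    by move=> [t1 t2] [/= _ h2]; exact: dr.
  have k1 := @for_continuous_fst _ _ _ _ _ r cvr.
  have k2 := @for_continuous_snd _ _ _ _ _ r (for_continuous_comp cvr (cw _)).
  exact: (for_continuous_comp (for_continuous_pair k1 k2) (@smooth_fun2_continuous _ _ _ _ _ _ sXK _)).
have : Phi s = Phi 0.
  move: (s0b); rewrite in_itv /= => /andP[s_ge0 s_leb].
  have H1 (t : R) : t \in `]0, s[ -> is_derive t (1 : R) Phi ((fun=> 0) t).
    rewrite in_itv /= => /andP[t0 ts]; apply: dPhi.
    by rewrite in_itv /= t0 (lt_le_trans ts).
  have H2 : {within `[0, s], continuous Phi}.
    apply: continuous_subspaceW cPhi => t /=; rewrite !in_itv /= => /andP[-> ts].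
    exact: le_trans s_leb.
  have [c _] := MVT_segment s_ge0 H1 H2.
  by rewrite mul0r => /eqP; rewrite subr_eq0 => /eqP.
by rewrite /Phi /K v0 invg1 mul1g => ->; congr (V _ y); apply/funext => x; rewrite mul1g.
Qed.

End LieGroup.

(** * Existence of integral curves *)

Section Picard.
Context {R : realType}.

Lemma div_pow2_small (C e : R) : 0 <= C -> 0 < e -> exists k, C / 2 ^+ k <= e.
Proof.
move=> C0 e0; exists (Num.bound (C / e)).
have := archi_boundP (divr_ge0 C0 (ltW e0)); set k := Num.bound _ => Ck.
rewrite ler_pdivrMr ?exprn_gt0 // mulrC -ler_pdivrMr //.
apply: le_trans (ltW Ck) _.
by rewrite -natrX ler_nat ltnW // ltn_expl.
Qed.

(** The limit is the supremum of the increasing lower bounds u_k - 2 C / 2^k. *)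
Lemma geometric_limit (u : nat -> R) (C : R) : 0 <= C ->
  (forall k, `|u k.+1 - u k| <= C / 2 ^+ k) ->
  exists l, forall k, `|u k - l| <= 2 * C / 2 ^+ k.
Proof.
move=> C0 Hu.
pose a k := u k - 2 * C / 2 ^+ k; pose b k := u k + 2 * C / 2 ^+ k.
have halve k : 2 * C / 2 ^+ k.+1 = C / 2 ^+ k.
  by rewrite exprS; field; rewrite expf_neq0.
have dbl k : 2 * C / 2 ^+ k = C / 2 ^+ k + C / 2 ^+ k by ring.
have aS k : a k <= a k.+1.
  rewrite /a halve dbl; have := Hu k; rewrite ler_norml => /andP[h _].
  by rewrite -subr_ge0; move: h; rewrite -subr_ge0; congr (_ <= _); ring.
have bS k : b k.+1 <= b k.
  rewrite /b halve dbl; have := Hu k; rewrite ler_norml => /andP[_ h].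
  by rewrite -subr_ge0; move: h; rewrite -subr_ge0; congr (_ <= _); ring.
have ab k : a k <= b k.
  by rewrite /a /b lerD2l ge0_cp // !mulr_ge0 // invr_ge0 exprn_ge0.
have ale k j : a k <= a (k + j)%N.
  by elim: j => [|j IH]; rewrite ?addn0 // addnS; exact: le_trans (aS _).
have ble k j : b (k + j)%N <= b k.
  by elim: j => [|j IH]; rewrite ?addn0 // addnS; exact: le_trans (bS _) _.
have abkj k j : a k <= b j.
  by apply: le_trans (ale k j) _; apply: le_trans (ab _) _; rewrite addnC.
pose l := sup (range a).
have hs : has_sup (range a).
  by split; [exists (a 0%N); exists 0%N|exists (b 0%N) => _ [k _ <-]].
exists l => k; rewrite ler_distlC; apply/andP; split.
  by apply: ub_le_sup; [exact: hs.2|exists k].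
by apply: ge_sup; [exact: hs.1|move=> _ [j _ <-]; exact: abkj].
Qed.

Lemma prim_sub_le (f g : R -> R) (x e : R) : continuous f -> continuous g ->
  0 <= x < 2 -> (forall t : R, 0 <= t <= x -> `|f t - g t| <= e) ->
  `|prim f x - prim g x| <= e * x.
Proof.
move=> cf cg x02 H.
have := @MVT_le R (fun x => prim f x - prim g x) (fun t => f t - g t) x e x02.
rewrite !prim0 subrr subr0; apply => // t ht.
by apply: is_deriveB; exact: is_derive_prim.
Qed.

Variables (n : nat) (y0 : 'rV[R]_n) (u : 'I_n -> 'rV[R]_n -> R) (L : R).
Hypothesis L0 : 0 < L.
Hypothesis u_lip : forall i y z, `|u i y - u i z| <= L * `|y - z|.

(* Time is clamped to [0, tau], so that the iterates are functions on the whole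
   line; tau is chosen such that L tau <= 1/2 and tau < 1. *)
Let tau : R := (2 * (L + 1))^-1.

Let tau0 : 0 < tau.
Proof. by rewrite invr_gt0 mulr_gt0 // ltr_wpDl // ltW. Qed.

Let tau1 : tau < 1.
Proof.
rewrite invf_lt1 ?mulr_gt0 // ?ltr_wpDl ?(ltW L0) //.
by rewrite mulrDr mulr1 ltr_wpDl // ?mulr_ge0 ?(ltW L0) // ltr1n.
Qed.

Let Ltau : L * tau <= 1 / 2.
Proof.
rewrite /tau ler_pdivrMr ?mulr_gt0 // ?ltr_wpDl ?(ltW L0) //.
by rewrite mulrA divfK // mul1r lerDl.
Qed.

Let kappa (t : R) : R := Num.max 0 (Num.min tau t).

Let kappa_in t : 0 <= kappa t <= tau.
Proof. by rewrite /kappa le_max lexx /= ge_max (ltW tau0) ge_min lexx. Qed.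

Let kappa_id t : 0 <= t <= tau -> kappa t = t.
Proof. by move=> /andP[h1 h2]; rewrite /kappa min_r // max_r. Qed.

Let kappa_lt2 t : 0 <= kappa t < 2.
Proof.
have /andP[-> /= h] := kappa_in t; apply: le_lt_trans h _.
by apply: lt_trans tau1 _; rewrite ltr1n.
Qed.

Let kappa_cts : continuous kappa.
Proof.
move=> t; apply: (@continuous_max _ _ (fun=> 0) (fun t => Num.min tau t)).
  exact: cvg_cst.
by apply: (@continuous_min _ _ (fun=> tau) id); [exact: cvg_cst|exact: cvg_id].
Qed.

Let u_cts i : continuous (u i).
Proof.
move=> y; apply/(@cvgrPdist_le _ _ _ _ (@nbhs_filter 'rV[R]_n y)) => e e0.
apply/nbhs_ballP; exists (e / L) => /=; first by rewrite divr_gt0.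
move=> z; rewrite -ball_normE /= => yz; apply: le_trans (u_lip _ _ _) _.
by rewrite -ler_pdivlMl // mulrC ltW.
Qed.

Let uZ_cts i (Z : R -> 'rV[R]_n) : continuous Z -> continuous (fun t => u i (Z t)).
Proof.
by move=> cZ t; exact: (@for_continuous_comp _ _ _ Z (u i) t (cZ t) (@u_cts i (Z t))).
Qed.

(* The integral operator of the equation Z' = u(Z), Z 0 = y0; it halves distances. *)
Let step (Z : R -> 'rV[R]_n) (t : R) : 'rV[R]_n :=
  \row_i (y0 ord0 i + prim (fun s => u i (Z s)) (kappa t)).

Let rV_cts (Z : R -> 'rV[R]_n) :
  (forall i, continuous (fun t => Z t ord0 i)) -> continuous Z.
Proof.
move=> cZ t; apply/(@cvgrPdist_le _ _ _ _ (@nbhs_filter _ t)) => e e0.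
have : \forall s \near t, forall i, `|Z t ord0 i - Z s ord0 i| <= e.
  apply: (@filter_forall _ _ _ (nbhs t)) => i.
  by have /cvgrPdist_le /(_ _ e0) := cZ i t.
apply: filterS => s Hs; apply: rV_norm_le; first exact: ltW.
by move=> i; rewrite !mxE; exact: Hs.
Qed.

Let step_cts (Z : R -> 'rV[R]_n) : continuous Z -> continuous (step Z).
Proof.
move=> cZ; apply: rV_cts => i t.
rewrite (_ : (fun t => _) = (fun t => y0 ord0 i + prim (fun s => u i (Z s)) (kappa t))); last first.
  by apply/funext => s; rewrite mxE.
apply: cvgD; first exact: cvg_cst.
have cp : {for kappa t, continuous (prim (fun s => u i (Z s)))}.
  apply: is_derive_continuous; apply: is_derive_prim; first exact: uZ_cts.
  by have /andP[h ->] := kappa_lt2 t; rewrite (lt_le_trans _ h) // ltrN10.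
exact: (@for_continuous_comp _ _ _ kappa _ t (@kappa_cts t) cp).
Qed.

Let step_contract (Z1 Z2 : R -> 'rV[R]_n) (e : R) : 0 <= e ->
  continuous Z1 -> continuous Z2 -> (forall t, `|Z1 t - Z2 t| <= e) ->
  forall t, `|step Z1 t - step Z2 t| <= e / 2.
Proof.
move=> e0 c1 c2 H t; apply: rV_norm_le; first by rewrite divr_ge0.
move=> i; rewrite !mxE opprD addrACA subrr add0r.
apply: (@le_trans _ _ (L * e * kappa t)).
  apply: prim_sub_le => //; [exact: uZ_cts|exact: uZ_cts|].
  by move=> s _; apply: le_trans (u_lip _ _ _) _; rewrite ler_pM2l.
rewrite mulrAC mulrC ler_wpM2l //; apply: le_trans _ (_ : L * tau <= _).
  by rewrite ler_pM2l //; have /andP[] := kappa_in t.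
by rewrite -[2^-1]mul1r; exact: Ltau.
Qed.

Lemma picard_lipschitz : exists (T : R) (Z : R -> 'rV[R]_n),
  [/\ 0 < T, continuous Z, Z 0 = y0 &
     forall t i, t \in `]0, T[ ->
       is_derive t (1 : R) (fun s => Z s ord0 i) (u i (Z t))].
Proof.
pose Zs k := iter k step (fun=> y0).
have cZs k : continuous (Zs k).
  by elim: k => [|k IH]; [move=> t; exact: cvg_cst|exact: step_cts].
pose C : R := \sum_i `|u i y0|.
have C0 : 0 <= C by apply: sumr_ge0.
have dZs k : forall t, `|Zs k.+1 t - Zs k t| <= C / 2 ^+ k.
  elim: k => [|k IH] t.
    rewrite expr0 divr1; apply: rV_norm_le => // i; rewrite !mxE addrAC subrr add0r.
    apply: (@le_trans _ _ (C * kappa t)).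
      apply: prim_le => //; first by move=> s; exact: cvg_cst.
      by move=> s _; rewrite /C (bigD1 i) //= lerDl sumr_ge0.
    rewrite ler_piMr //; have /andP[_ h] := kappa_in t.
    exact: le_trans h (ltW tau1).
  rewrite exprSr invfM mulrA; apply: (@step_contract (Zs k.+1) (Zs k)) => //.
  by rewrite divr_ge0 ?exprn_ge0.
have lim_ex t i : exists l, forall k, `|Zs k t ord0 i - l| <= 2 * C / 2 ^+ k.
  apply: geometric_limit => // k; apply: le_trans (dZs k t).
  by have := coord_norm_le (Zs k.+1 t - Zs k t) i; rewrite !mxE.
have [l Hl] := choice (fun p : R * 'I_n => lim_ex p.1 p.2).
pose Z t : 'rV[R]_n := \row_i l (t, i).
have HZ k t : `|Zs k t - Z t| <= 2 * C / 2 ^+ k.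
  apply: rV_norm_le; first by rewrite !mulr_ge0 // invr_ge0 exprn_ge0.
  by move=> i; rewrite !mxE; exact: (Hl (t, i)).
have C20 : 0 <= 2 * C by rewrite mulr_ge0.
have cZ : continuous Z.
  move=> t; apply/(@cvgrPdist_le _ _ _ _ (@nbhs_filter _ t)) => e e0.
  have e30 : 0 < e / 3 by rewrite divr_gt0.
  have [k Hk] := div_pow2_small C20 e30.
  have /cvgrPdist_le /(_ _ e30) := cZs k t.
  apply: filterS => s hs.
  have -> : Z t - Z s = (Z t - Zs k t) + (Zs k t - Zs k s) + (Zs k s - Z s).
    by rewrite !subrKA.
  apply: le_trans (ler_normD _ _) _.
  have -> : e = e / 3 + e / 3 + e / 3 by field.
  apply: lerD; last exact: le_trans (HZ k s) Hk.
  apply: le_trans (ler_normD _ _) _; apply: lerD => //.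
  by rewrite distrC; exact: le_trans (HZ k t) Hk.
have fixZ t : Z t = step Z t.
  apply/eqP; rewrite -subr_eq0 -normr_le0; apply/ler_addgt0Pl => e e0; rewrite addr0.
  have e20 : 0 < e / 2 by rewrite divr_gt0.
  have [k Hk] := div_pow2_small C20 e20.
  have -> : Z t - step Z t = (Z t - Zs k.+1 t) + (Zs k.+1 t - step Z t).
    by rewrite subrKA.
  apply: le_trans (ler_normD _ _) _; rewrite [e]splitr; apply: lerD.
    rewrite distrC; apply: le_trans (HZ _ _) _; apply: le_trans Hk.
    rewrite exprS invfM mulrCA ler_piMl //.
      by rewrite mulr_ge0 // invr_ge0 exprn_ge0.
    by rewrite invf_le1 // ler1n.
  apply: le_trans (_ : 2 * C / 2 ^+ k / 2 <= _).
    by apply: (@step_contract (Zs k) Z) => //; rewrite divr_ge0 ?exprn_ge0.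
  rewrite ler_pdivrMr //; apply: le_trans Hk _.
  by rewrite ler_peMr ?(ltW e20) // ler1n.
exists tau, Z; split => //.
  apply/rowP => i; rewrite fixZ mxE kappa_id ?lexx ?(ltW tau0) //.
  by rewrite prim0 addr0.
move=> t i t0; have t02 := t0; rewrite in_itv /= in t02; have /andP[tp tt] := t02.
have d1 : is_derive t (1 : R) (prim (fun s => u i (Z s))) (u i (Z t)).
  apply: is_derive_prim; first exact: uZ_cts.
  rewrite (lt_trans _ tp) ?ltrN10 //=; apply: lt_trans tt _.
  by apply: lt_trans tau1 _; rewrite ltr1n.
have d2 := is_deriveD (is_derive_cst (y0 ord0 i) t (1 : R)) d1.
rewrite add0r in d2; apply: near_eq_is_derive d2.
have : \forall s \near t, s \in `]0, tau[ by exact: near_in_itvoo.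
apply: filterS => s; rewrite in_itv /= => /andP[s0 st].
by rewrite [in RHS]fixZ mxE kappa_id // !ltW.
Qed.

End Picard.

Section LocalExistence.
Context {R : realType}.

(** The partial derivatives are bounded near y0, and balls are convex. *)
Lemma smooth_lipschitz m n (w : 'I_m -> 'rV[R]_n -> R) (y0 : 'rV[R]_n) :
  (forall k, smooth_on setT (w k)) ->
  exists r K : R, [/\ 0 < r, 0 < K & forall k y z,
    `|y - y0| <= r -> `|z - y0| <= r -> `|w k y - w k z| <= K * `|y - z|].
Proof.
move=> sw.
have cD k i : {for y0, continuous (fun y => 'D_('e_i) (w k) y)}.
  exact: (smooth_on_continuous (smooth_on_derive 'e_i (sw k))).
have near1 : \forall y \near y0, forall k i,
    `|'D_('e_i) (w k) y| <= `|'D_('e_i) (w k) y0| + 1.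
  apply: (@filter_forall _ _ _ (nbhs y0)) => k.
  apply: (@filter_forall _ _ _ (nbhs y0)) => i.
  have /cvgrPdist_le /(_ _ ltr01) := cD k i.
  apply: filterS => y hy; rewrite -lerBlDl.
  by apply: le_trans (lerB_dist _ _) _; rewrite distrC.
move: near1 => /nbhs_ballP[r /= r0 Hr].
pose K k := \sum_(i < n) (`|'D_('e_i) (w k) y0| + 1).
have K0 k : 0 <= K k by apply: sumr_ge0 => i _; rewrite addr_ge0.
exists (r / 2), (\sum_k K k + 1); split; first by rewrite divr_gt0.
  by rewrite ltr_wpDl // sumr_ge0.
move=> k y z hy hz.
apply: (@le_trans _ _ (K k * `|y - z|)); last first.
  apply: ler_wpM2r => //; rewrite (bigD1 k) //= -addrA lerDl.
  by rewrite addr_ge0 // sumr_ge0.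
have in_ball (s : R) : 0 <= s <= 1 -> ball y0 r (z + s *: (y - z)).
  move=> /andP[s0 s1]; rewrite -ball_normE /=.
  apply: (@le_lt_trans _ _ (r / 2)); last by rewrite ltr_pdivrMr // ltr_pMr // ltr1n.
  rewrite distrC.
  have -> : z + s *: (y - z) - y0 = s *: (y - y0) + (1 - s) *: (z - y0).
    by apply/rowP => i; rewrite !mxE; ring.
  apply: le_trans (ler_normD _ _) _; rewrite !normrZ !ger0_norm ?subr_ge0 //.
  have -> : r / 2 = s * (r / 2) + (1 - s) * (r / 2) by ring.
  by apply: lerD; apply: ler_wpM2l => //; rewrite subr_ge0.
have dw x : differentiable (w k) x by exact: smooth_on_differentiable (sw k) _.
have [s s01 E] := @MVT0 R (fun s => w k (z + s *: (y - z))) _ 1 ler01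
  (fun s _ => is_derive_line (dw (z + s *: (y - z)))).
have Ez : z + (y - z) = y by rewrite addrC subrK.
rewrite scale1r scale0r addr0 mulr1 Ez in E.
rewrite E derive_rV // /K mulr_suml; apply: le_trans (ler_norm_sum _ _ _) _.
apply: ler_sum => i _; rewrite normrM mulrC; apply: ler_pM => //.
  by apply: Hr; apply: in_ball; move: s01; rewrite in_itv.
by rewrite coord_norm_le.
Qed.

Let clamp (a b s : R) := Num.max a (Num.min b s).

Let clamp_lip a b s t : `|clamp a b s - clamp a b t| <= `|s - t|.
Proof.
wlog st : s t / s <= t => [H|].
  by case: (leP s t) => [/H //|/ltW /H]; rewrite distrC [leRHS]distrC.
have h1 : clamp a b s <= clamp a b t.
  by rewrite /clamp ge_max !le_max lexx /= orbC; apply/orP; left; rewrite le_min ge_min lexx /= ge_min st orbT.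
rewrite distrC [leRHS]distrC !ger0_norm ?subr_ge0 // /clamp.
have h2 : Num.min b t <= Num.min b s + (t - s).
  by rewrite /Num.min; case: ltP => h2; case: ltP => h3; lra.
by rewrite lerBlDr ge_max; apply/andP; split; rewrite /Num.max; case: ltP => h3; lra.
Qed.

(** Clamping the coordinates is 1-Lipschitz and changes nothing near y0; it turns
the local Lipschitz bound into a global one. *)
Lemma picard_smooth n (w : 'I_n -> 'rV[R]_n -> R) (y0 : 'rV[R]_n) :
  (forall i, smooth_on setT (w i)) ->
  exists (T : R) (Z : R -> 'rV[R]_n),
  [/\ 0 < T, continuous Z, Z 0 = y0 &
     forall t i, t \in `]0, T[ ->
       is_derive t (1 : R) (fun s => Z s ord0 i) (w i (Z t))].
Proof.
move=> sw; have [r [K [r0 K0 lipw]]] := smooth_lipschitz y0 sw.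
pose rho (y : 'rV[R]_n) : 'rV[R]_n :=
  \row_i clamp (y0 ord0 i - r) (y0 ord0 i + r) (y ord0 i).
have rho_in y : `|rho y - y0| <= r.
  apply: rV_norm_le; first exact: ltW.
  move=> i; rewrite !mxE ler_distl /clamp le_max lexx /= ge_max ge_min lexx /= andbT.
  by lra.
have rho_id y : `|y - y0| <= r -> rho y = y.
  move=> yr; apply/rowP => i; rewrite mxE /clamp.
  have := le_trans (coord_norm_le (y - y0) i) yr; rewrite !mxE ler_distl => /andP[h1 h2].
  by rewrite min_r // max_r.
have lipu i y z : `|w i (rho y) - w i (rho z)| <= K * `|y - z|.
  apply: le_trans (lipw _ _ _ (rho_in y) (rho_in z)) _; rewrite ler_pM2l //.
  apply: rV_norm_le => // j; rewrite !mxE; apply: le_trans (clamp_lip _ _ _ _) _.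
  by have := coord_norm_le (y - z) j; rewrite !mxE.
have [T [Z [T0 cZ Z0 dZ]]] := @picard_lipschitz R n y0 (fun i y => w i (rho y)) K K0 lipu.
have near1 : \forall t \near (0 : R), `|Z t - y0| <= r.
  have /(@cvgrPdist_le _ _ _ _ (@nbhs_filter _ (0 : R))) /(_ _ r0) := cZ 0.
  by apply: filterS => t; rewrite Z0 distrC.
move: near1 => /nbhs_ballP[d /= d0 Hd].
exists (Num.min T d), Z; split => //; first by rewrite lt_min T0.
move=> t i; rewrite in_itv /= lt_min => /and3P[t0 tT td].
have := dZ t i; rewrite in_itv /= t0 tT => /(_ isT).
by rewrite rho_id //; apply: Hd; rewrite -ball_normE /= sub0r normrN gtr0_norm.
Qed.

(** The equation is solved in a chart, for global extensions of the coefficients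
of [X]; for short times the solution stays where they agree with [X]. *)
Lemma curve_of_exists n (M : manifoldType R n) (X : vfield M) (x0 : M) :
  is_vfield X -> exists (b : R) (v : R -> M), [/\ 0 < b, v 0 = x0 & curve_of X 0 b v].
Proof.
move=> hX; have [c ac cx0] := atlas_cover x0.
have [a [sa nearx]] := vf_local_expr hX ac cx0.
have imx := chart_im_fun cx0.
have W i : exists g : 'rV[R]_n -> R, smooth_on setT g /\
    \forall y \near c x0, g y = a i (chart_inv c y).
  have [g [K [sg ng _ _ _]]] := smooth_ext_rV (@open_chart_im _ _ _ c) imx (sa i c ac).
  by exists g.
have [w Hw] := choice W.
have [T [Z [T0 cZ Z0 dZ]]] := picard_smooth (c x0) (fun i => (Hw i).1).
have near1 : \forall y \near c x0, [/\ chart_im c y,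
    forall i, w i y = a i (chart_inv c y) &
    forall f, smooth_fun f -> X f (chart_inv c y) =
      \sum_(i < n) a i (chart_inv c y) * 'D_('e_i) (f \o chart_inv c) y].
  have n1 : \forall y \near c x0, chart_im c y.
    by apply: open_nbhs_nbhs; split => //; exact: open_chart_im.
  have n2 : \forall y \near c x0, forall i, w i y = a i (chart_inv c y).
    by apply: (@filter_forall _ _ _ (nbhs (c x0))) => i; exact: (Hw i).2.
  have := chart_inv_continuous imx; rewrite /prop_for /continuous_at chart_funK // => cinv.
  have n3 := cinv _ nearx.
  near=> y; have ic : chart_im c y by near: y.
  split => //; first by near: y.
  move=> f sf; have : chart_dom c (chart_inv c y) /\ (forall f, smooth_fun f ->
    X f (chart_inv c y) = \sum_(i < n) a i (chart_inv c y) *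
      'D_('e_i) (f \o chart_inv c) (c (chart_inv c y))) by near: y.
  by move=> [_ ->//]; have [_ ->] := chart_imP ic.
have : \forall t \near (0 : R), [/\ chart_im c (Z t),
    forall i, w i (Z t) = a i (chart_inv c (Z t)) &
    forall f, smooth_fun f -> X f (chart_inv c (Z t)) =
      \sum_(i < n) a i (chart_inv c (Z t)) * 'D_('e_i) (f \o chart_inv c) (Z t)].
  by have := cZ 0; rewrite /continuous_at Z0 => cZ0; exact: cZ0 near1.
move=> /nbhs_ballP[d /= d0 Hd].
have d20 : 0 < d / 2 by rewrite divr_gt0.
exists (Num.min T (d / 2)), (fun t => chart_inv c (Z t)); split.
- by rewrite lt_min T0.
- by rewrite Z0 chart_funK.
have in_d (t : R) : 0 <= t <= d / 2 -> ball (0 : R) d t.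
  move=> /andP[t0 td]; rewrite -ball_normE /= sub0r normrN ger0_norm //.
  by apply: le_lt_trans td _; rewrite ltr_pdivrMr // ltr_pMr // ltr1n.
split.
  apply: continuous_in_subspaceT => t; rewrite inE /= in_itv /= le_min => /and3P[t0 _ td].
  have [ic _ _] := Hd _ (in_d t (introT andP (conj t0 td))).
  exact: (@for_continuous_comp _ _ _ Z (chart_inv c) t (cZ t) (chart_inv_continuous ic)).
move=> t; rewrite in_itv /= lt_min => /and3P[t0 tT td] f sf.
have [|ic Ew EX] := Hd t; first by apply: in_d; rewrite !ltW.
have t0T : t \in `]0, T[ by rewrite in_itv /= t0 tT.
have dZt : derivable Z t 1.
  by apply/derivable_mxP => i j; rewrite (ord1 i); have d1 := dZ t j t0T; exact: ex_derive.
have dZt' : differentiable Z t by apply/derivable1_diffP.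
have dg : differentiable (f \o chart_inv c) (Z t).
  exact: smooth_on_differentiable (sf c ac) ic.
have lE (q : 'rV[R]_n) : q = \sum_i q ord0 i *: 'e_i by rewrite -row_sum_delta.
have D := @derive_comp_coords R R _ _ n (fun i => 'e_i) (fun i (q : 'rV[R]_n) => q ord0 i)
  Z (f \o chart_inv c) t 1 lE dZt' dg.
have dgZ : derivable ((f \o chart_inv c) \o Z) t 1.
  by apply/derivable1_diffP; exact: differentiable_comp.
split; first exact: dgZ.
rewrite -[LHS]/('D_1 ((f \o chart_inv c) \o Z) t) D EX //.
apply: eq_bigr => i _; rewrite -Ew derive_mx // mxE.
by have d1 := dZ t i t0T; rewrite derive_val.
Unshelve. all: by end_near. Qed.

End LocalExistence.

(** * Concatenation of trajectories *)

Section Gluing.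
Context {R : realType} {T : topologicalType}.
Implicit Types (f g : R -> T).

Lemma within_continuous_glue f g (a b c : R) : a <= b -> b <= c -> f b = g b ->
  {within `[a, b], continuous f} -> {within `[b, c], continuous g} ->
  {within `[a, c], continuous (fun r => if r <= b then f r else g r)}.
Proof.
move=> ab bc fg cf cg.
have -> : `[a, c]%classic = `[a, b]%classic `|` `[b, c]%classic.
  apply/seteqP; split => r; rewrite /= !in_itv /=.
    move=> /andP[ar rc]; case: (leP r b) => rb; first by left; rewrite ar.
    by right; rewrite ltW.
  move=> [/andP[ar rb]|/andP[br rc]]; first by rewrite ar (le_trans rb).
  by rewrite rc andbT (le_trans ab).
apply: withinU_continuous; [exact: interval_closed|exact: interval_closed| |].
  apply: subspace_eq_continuous cf => r; rewrite inE /= in_itv /= => /andP[_ rb].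
  by rewrite /from_subspace rb.
apply: subspace_eq_continuous cg => r; rewrite inE /= in_itv /= => /andP[br _].
rewrite /from_subspace; case: (leP r b) => // rb.
by rewrite (@le_anti _ _ r b) // rb.
Qed.

Lemma within_continuous_shift f (a b s : R) : {within `[a, b], continuous f} ->
  {within `[a + s, b + s], continuous (fun r => f (r - s))}.
Proof.
move=> /subspace_continuousP cf; apply/subspace_continuousP => r.
rewrite /= in_itv /= => /andP[ar rb].
have rs : `[a, b]%classic (r - s) by rewrite /= in_itv /= lerBrDr ar lerBlDr.
have cs : {for r, continuous (fun q : R => q - s)}.
  by apply: cvgB; [exact: cvg_id|exact: cvg_cst].
have H : (fun q : R => q - s) @ within `[a + s, b + s] (nbhs r) -->
    within `[a, b] (nbhs (r - s)).
  move=> Q HQ.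
  have HQ' : nbhs (r - s) [set y : R | `[a, b]%classic y -> Q y] := HQ.
  suff : nbhs r [set q : R | `[a + s, b + s]%classic q -> Q (q - s)] by [].
  have H3 : nbhs r [set q : R | `[a, b]%classic (q - s) -> Q (q - s)] := cs _ HQ'.
  apply: (@filterS _ (nbhs r) (@nbhs_filter _ r) _ _ _ H3) => q /= Hq.
  rewrite in_itv /= => /andP[aq qb].
  by apply: Hq; rewrite in_itv /= lerBrDr aq lerBlDr.
exact: (cvg_comp _ f H (cf _ rs)).
Qed.

Lemma is_derive_shift_right (h : R -> R) (r s d : R) : is_derive (r - s) (1 : R) h d ->
  is_derive r (1 : R) (fun q => h (q - s)) d.
Proof.
move=> /is_derive1P H; apply/is_derive1P => e e0; apply: filterS (H e e0) => q.
by rewrite (addrAC r).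
Qed.

End Gluing.

Section Trajectories.
Context {R : realType} {n : nat} {M : manifoldType R n} {m : nat}.
Variables (F : 'rV[R]_m -> vfield M) (U : set 'rV[R]_m).

Lemma admissible_ge0 (t : R) u : admissible U t u -> 0 <= t.
Proof. by move=> [_ [sub /itv_partition_le]]. Qed.

Lemma admissible_cat (s t : R) u1 u2 : admissible U s u1 -> admissible U t u2 ->
  admissible U (s + t) (fun r => if r < s then u1 r else u2 (r - s)).
Proof.
move=> A1 A2; have s0 := admissible_ge0 A1; have t0 := admissible_ge0 A2.
case: A1 => U1 [sub1 p1 H1]; case: A2 => U2 [sub2 p2 H2]; split.
  move=> r; rewrite in_itv /= => /andP[r0 rst]; case: ltP => rs.
    by apply: U1; rewrite in_itv /= r0 ltW.
  by apply: U2; rewrite in_itv /= subr_ge0 rs lerBlDl.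
exists (sub1 ++ [seq x + s | x <- sub2]).
  apply: itv_partition_cat p1 _; case: p2 => [p2 /eqP l2]; split.
    rewrite -{1}[s]add0r; elim: sub2 {l2 H2} 0 p2 => //= x l IH z /andP[zx xl].
    by rewrite ltrD2r zx IH.
  have -> : last s [seq x + s | x <- sub2] = last (0 + s) [seq x + s | x <- sub2].
    by rewrite add0r.
  by rewrite (last_map (fun x => x + s)) l2 addrC.
case: (p1) => [_ /eqP l1] i; rewrite size_cat size_map => Hi.
have [i1|i1] := ltnP i (size sub1).
  have E1 : nth 0 (0 :: sub1 ++ [seq x + s | x <- sub2]) i = nth 0 (0 :: sub1) i.
    by rewrite -cat_cons nth_cat /= ltnS ltnW.
  have E2 : nth 0 (sub1 ++ [seq x + s | x <- sub2]) i = nth 0 sub1 i.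
    by rewrite nth_cat i1.
  rewrite E1 E2 => r r' Hr Hr'.
  have le_s : nth 0 sub1 i <= s.
    have /= := itv_partition_nth_le (i1 : i.+1 < (size sub1).+1)%N p1.
    by rewrite (set_nth_default 0).
  have lt_s q : q \in `]nth 0 (0 :: sub1) i, nth 0 sub1 i[ -> q < s.
    by rewrite in_itv /= => /andP[_ /lt_le_trans]; exact.
  by rewrite (lt_s _ Hr) (lt_s _ Hr'); exact: (H1 i).
have ji : (i - size sub1 < size sub2)%N by rewrite ltn_subLR.
have E1 : nth 0 (0 :: sub1 ++ [seq x + s | x <- sub2]) i = nth 0 (0 :: sub2) (i - size sub1) + s.
  move: i1; rewrite leq_eqVlt => /orP[/eqP <-|i1].
    by rewrite subnn /= add0r -cat_cons nth_cat /= ltnS leqnn -l1 -last_nth.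
  rewrite -cat_cons nth_cat /= ltnS leqNgt i1 /=.
  have -> : (i - size sub1 = (i - (size sub1).+1).+1)%N by rewrite subnS prednK // subn_gt0.
  rewrite /= (nth_map 0) //; apply: leq_ltn_trans ji.
  by rewrite leq_sub2l.
have E2 : nth 0 (sub1 ++ [seq x + s | x <- sub2]) i = nth 0 sub2 (i - size sub1) + s.
  by rewrite nth_cat ltnNge i1 /= (nth_map 0).
rewrite E1 E2 => r r' Hr Hr'.
have ge_0 : 0 <= nth 0 (0 :: sub2) (i - size sub1).
  have := itv_partition_nth_ge (ltnW ji : i - size sub1 < (size sub2).+1)%N p2.
  by rewrite (set_nth_default 0) //= ltnS ltnW.
have inr q : q \in `]nth 0 (0 :: sub2) (i - size sub1) + s, nth 0 sub2 (i - size sub1) + s[ ->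
    (q < s) = false /\ q - s \in `]nth 0 (0 :: sub2) (i - size sub1), nth 0 sub2 (i - size sub1)[.
  rewrite !in_itv /= => /andP[h1 h2]; split; last by rewrite ltrBrDr h1 ltrBlDr.
  by apply/negbTE; rewrite -leNgt ltW // (le_lt_trans _ h1) // lerDr.
have [-> h1] := inr _ Hr; have [-> h2] := inr _ Hr'; exact: (H2 _ ji).
Qed.

Lemma trajectory_cat (s t : R) u1 u2 g1 g2 : 0 <= s -> 0 <= t -> g1 s = g2 0 ->
  trajectory F s u1 g1 -> trajectory F t u2 g2 ->
  trajectory F (s + t) (fun r => if r < s then u1 r else u2 (r - s))
    (fun r => if r <= s then g1 r else g2 (r - s)).
Proof.
move=> s0 t0 g12 [c1 [S1 fS1 d1]] [c2 [S2 fS2 d2]]; split.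
  apply: within_continuous_glue => //; rewrite ?lerDl ?subrr //.
  by have := @within_continuous_shift R _ g2 0 t s c2; rewrite add0r addrC.
(* The junction joins the exceptional times, as the curve may have a corner. *)
exists (S1 `|` [set s] `|` [set x + s | x in S2]).
  by rewrite !finite_setU; split; [split => //; exact: finite_set1|exact: finite_image].
move=> r; rewrite in_itv /= => /andP[r0 rst] nS f sf.
have rs : r != s by apply/eqP => E; apply: nS; left; right.
have [ltrs|ltsr|E] := ltrgtP r s; last by rewrite E eqxx in rs.
  apply: (@near_eq_is_derive _ _ _ (fun r => f (g1 r))).
    near=> q; rewrite ifT // ltW //; near: q; exact: lt_nbhsl.
  apply: d1 => //; first by rewrite in_itv /= r0.
  by move=> S1r; apply: nS; left; left.
apply: (@near_eq_is_derive _ _ _ (fun r => f (g2 (r - s)))).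
  near=> q; rewrite leNgt ifN // negbK; near: q; exact: lt_nbhsr.
apply: (@is_derive_shift_right R (fun q => f (g2 q))); apply: d2 => //.
  by rewrite in_itv /= subr_gt0 ltsr ltrBlDl.
by move=> S2r; apply: nS; right; exists (r - s) => //; rewrite subrK.
Unshelve. all: by end_near. Qed.

Lemma reachable_trans g h k : reachable F U g h -> reachable F U h k ->
  reachable F U g k.
Proof.
move=> [s s0 [u1 [g1 [A1 T1 <- E1]]]] [t t0 [u2 [g2 [A2 T2 E2 <-]]]].
rewrite /= in s0 t0; exists (s + t); first by rewrite /= addr_gt0.
exists (fun r => if r < s then u1 r else u2 (r - s)),
  (fun r => if r <= s then g1 r else g2 (r - s)); split.
- exact: admissible_cat.
- by apply: trajectory_cat => //; rewrite ?ltW // E1 E2.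
- by rewrite ltW.
- by rewrite leNgt ltrDl t0 /= addrAC subrr add0r.
Qed.

End Trajectories.

(** * Controllability of affine systems *)

Section SegmentChain.
Context {R : realType}.

(** A property that is locally constant along an interval is constant, the
interval being connected. *)
Lemma segment_chain (D : R -> Prop) (T : R) : D 0 ->
  (forall r : R, r \in `[0, T] -> \forall s \near r, s \in `[0, T] -> (D r <-> D s)) ->
  forall r : R, r \in `[0, T] -> D r.
Proof.
move=> D0 nD r rT; have cT := @segment_connected R 0 T.
have T0 : 0 <= T by move: rT; rewrite in_itv /= => /andP[/le_trans]; exact.
have : [set s | s \in `[0, T] /\ D s] = `[0, T]%classic.
  apply: cT.
  - by exists 0; split => //; rewrite in_itv /= lexx.
  - exists [set s | s \in `[0, T] -> D s]°; first exact: open_interior.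
    apply/seteqP; split => s /= [sT].
      move=> Ds; split => //; apply: filterS (nD s sT) => q h qT.
      by apply/(h qT).
    by move=> /interior_subset; split => //; auto.
  - exists (~` [set s | s \in `[0, T] -> ~ D s]°).
      by apply: open_closedC; exact: open_interior.
    apply/seteqP; split => s /= [sT].
      by move=> Ds; split => // /interior_subset; exact.
    move=> ns; split => //; apply: contrapT => nDs; apply: ns.
    apply: filterS (nD s sT) => q h qT Dq.
    by apply: nDs; apply/(h qT).
by move=> /seteqP[_ /(_ r rT)] [].
Qed.

End SegmentChain.

Section Centralizer.
Context {R : realType} {n : nat} {G : lieGroupType R n} {I : Type}.
Variable W : I -> vfield G.

(** Left translation by [z] preserves every [W i]. A right invariant field is
determined by its value at 1, and this says that Ad z fixes that value. *)
Definition centralizes (z : G) : Prop := forall i f, smooth_fun f ->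
  forall y, W i (fun x => f (z * x)%g) y = W i f (z * y)%g.

Lemma centralizes1 : centralizes 1%g.
Proof.
by move=> i f sf y; rewrite mul1g; congr (W i _ y); apply/funext => x; rewrite mul1g.
Qed.

Lemma centralizesM x y : centralizes x -> centralizes y -> centralizes (x * y)%g.
Proof.
move=> cx cy i f sf z; rewrite -mulgA -cx // -cy; last exact: smooth_lmul.
by congr (W i _ z); apply/funext => w; rewrite mulgA.
Qed.

Lemma centralizesV x : centralizes x -> centralizes x^-1%g.
Proof.
move=> cx i f sf y; rewrite -{1}[y](mulVKg x).
rewrite -[LHS]cx; last exact: smooth_lmul.
by congr (W i _ _); apply/funext => w; rewrite mulKg.
Qed.

(** Under inversion, right translation by z becomes left translation by z^-1,
which preserves [W i] along with z. *)
Lemma dI_centralizes z i f x : centralizes z -> smooth_fun f ->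
  dI (W i) (fun y => f (y * z)%g) x = dI (W i) f (x * z)%g.
Proof.
move=> /centralizesV cz sf; rewrite /dI invgM -cz; last exact: smooth_inv.
by congr (W i _ _); apply/funext => w; rewrite invgM invgK.
Qed.

End Centralizer.

Section AffineSystem.
Context {R : realType} {n m : nat} {G : lieGroupType R n}.
Variables (W P A : 'rV[R]_m -> vfield G) (U : set 'rV[R]_m).
Hypothesis W_inv : forall u, right_invariant (W u).
Hypothesis P_inv : forall u, right_invariant (P u).
Hypothesis A_decomp : forall u, vf_eq (A u) (vf_add (P u) (dI (W u))).
Hypothesis W_comm : forall u w, vf_eq (vf_bracket (W u) (W w)) (@vf0 R n G).
Hypothesis W_one : forall u f, smooth_fun f -> dI (W u) f 1%g = - W u f 1%g.

Local Notation Cen := (centralizes W).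

(** The field A u is the sum of P u, preserved by all right translations, and of
dI (W u), preserved by those that centralize. *)
Lemma reachable_rmul z g h : Cen z -> reachable A U g h ->
  reachable A U (g * z)%g (h * z)%g.
Proof.
move=> cz [t t0 [u [gamma [Au [cg [S fS dg]] <- <-]]]]; exists t => //.
exists u, (fun r => gamma r * z)%g; split => //; split.
  by apply: within_continuous_mulg => //; exact: cst_continuous.
exists S => // s st nS f sf.
have := dg s st nS _ (smooth_rmul z sf).
rewrite !A_decomp //; last exact: smooth_rmul.
by rewrite /vf_add dI_centralizes // (P_inv (u s)).2.
Qed.

(** The curve [v] solves v' = dI (W u) (v) at time [r], near which the control is
constant. The equation is stated for all left translates x * v at once,
which is how it is used; they satisfy it by left invariance. *)
Definition compensates (u : R -> 'rV[R]_m) (v : R -> G) (r : R) : Prop :=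
  (\forall q \near r, u q = u r) /\
  forall f, smooth_fun f -> forall x : G,
    is_derive r (1 : R) (fun q => f (x * v q)%g) (dI (W (u r)) f (x * v r)%g).

Definition compensator (u : R -> 'rV[R]_m) (a b : R) (v : R -> G) : Prop :=
  [/\ v a = 1%g, {within `[a, b], continuous v}, forall r, r \in `[a, b] -> Cen (v r) &
      exists2 S : set R, finite_set S &
        forall r, r \in `]a, b[ -> ~ S r -> compensates u v r].

Lemma compensator_refl u a : compensator u a a (fun=> 1%g).
Proof.
split => //.
- exact: cst_continuous.
- by move=> r _; exact: centralizes1.
- exists set0 => // r; rewrite in_itv /= => /andP[ar ra].
  by have := lt_trans ar ra; rewrite ltxx.
Qed.

Lemma compensates_near u v v' x0 r : (\forall q \near r, v q = (x0 * v' q)%g) ->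
  compensates u v' r -> compensates u v r.
Proof.
move=> vE [cu dv]; split => // f sf x; rewrite (nbhs_singleton vE) mulgA.
apply: (@near_eq_is_derive _ _ _ (fun q => f (x * x0 * v' q)%g)); last exact: dv.
by apply: filterS vE => q ->; rewrite mulgA.
Qed.

Lemma compensator_cat u a b c v1 v2 : a <= b -> b <= c ->
  compensator u a b v1 -> compensator u b c v2 ->
  compensator u a c (fun r => if r <= b then v1 r else (v1 b * v2 r)%g).
Proof.
move=> ab bc [i1 c1 z1 [S1 f1 d1]] [i2 c2 z2 [S2 f2 d2]]; split.
- by rewrite ab.
- apply: within_continuous_glue => //; first by rewrite i2 mulg1.
  by apply: within_continuous_mulg => //; exact: cst_continuous.
- move=> r; rewrite in_itv /= => /andP[ar rc]; case: leP => rb.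
    by apply: z1; rewrite in_itv /= ar.
  apply: centralizesM; first by apply: z1; rewrite in_itv /= ab lexx.
  by apply: z2; rewrite in_itv /= rc ltW.
exists (S1 `|` [set b] `|` S2).
  by rewrite !finite_setU; split; [split => //; exact: finite_set1|].
move=> r; rewrite in_itv /= => /andP[ar rc] nS.
have rb : r != b by apply/eqP => E; apply: nS; left; right.
have [ltrb|ltbr|E] := ltrgtP r b; last by rewrite E eqxx in rb.
  apply: (@compensates_near _ _ v1 1%g).
    near=> q; rewrite mul1g ifT // ltW //; near: q; exact: lt_nbhsl.
  apply: d1; first by rewrite in_itv /= ar.
  by move=> S1r; apply: nS; left; left.
apply: (@compensates_near _ _ v2 (v1 b)).
  near=> q; rewrite leNgt ifN // negbK; near: q; exact: lt_nbhsr.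
apply: d2; first by rewrite in_itv /= ltbr.
by move=> S2r; apply: nS; right.
Unshelve. all: by end_near. Qed.

(** The length [e] depends on the control value alone, as the equation is
autonomous; intervals of any length can therefore be covered. *)
Lemma compensator_short w : exists2 e : R, 0 < e & forall u a b,
  a <= b -> b - a <= e -> (forall r, r \in `]a, b[ -> u r = w) ->
  exists v, compensator u a b v.
Proof.
have [e [v [e0 v0 [cv dv]]]] := @curve_of_exists R n G _ 1%g (dI_vfield (W_inv w).1).
exists e => // u a b ab abe uw; exists (fun r => v (r - a)).
have cen r : r \in `[0, e] -> Cen (v r).
  move=> re i f sf y.
  exact: (curve_of_left_invariant (W_inv w) (W_inv i) (W_comm w i) (W_one w) (conj cv dv)).
split.
- by rewrite subrr.
- have := @within_continuous_shift R _ v 0 (b - a) a; rewrite add0r subrK; apply.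
  apply: continuous_subspaceW cv => r /=; rewrite !in_itv /= => /andP[-> /le_trans]; exact.
- move=> r; rewrite in_itv /= => /andP[ar rb]; apply: cen.
  by rewrite in_itv /= subr_ge0 ar (le_trans _ abe) // lerD2r.
exists set0 => // r rab _; have rab' := rab; move: rab'.
rewrite in_itv /= => /andP[ar rb]; split.
  by apply: filterS (near_in_itvoo rab) => q qab; rewrite !uw.
move=> f sf x; rewrite uw //.
apply: (@is_derive_shift_right R (fun q => f (x * v q)%g)).
have rae : r - a \in `]0, e[.
  by rewrite in_itv /= subr_gt0 ar (lt_le_trans _ abe) // ltrD2r.
by have := dv _ rae _ (smooth_lmul x sf); rewrite dI_left_invariant.
Qed.

(** The equation being left invariant, the solution over a short interval can be
restarted from any point and prolonged ([compensator_cat]). *)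
Lemma compensator_cst u a b w : a <= b -> (forall r, r \in `]a, b[ -> u r = w) ->
  exists v, compensator u a b v.
Proof.
have [e e0 He] := compensator_short w => ab uw.
have [N HN] : exists N : nat, b - a <= N%:R * e.
  exists (Num.bound ((b - a) / e)); rewrite -ler_pdivrMr // ltW //.
  by rewrite archi_boundP // divr_ge0 ?subr_ge0 // ltW.
elim: N a ab uw HN => [|N IH] a ab uw.
  rewrite mul0r subr_le0 => ba; have -> : b = a by apply/le_anti; rewrite ba ab.
  by exists (fun=> 1%g); exact: compensator_refl.
rewrite -natr1 mulrDl mul1r => HN.
have [be|eb] := leP (b - a) e; first exact: He.
have ac : a <= a + e by rewrite lerDl ltW.
have cb : a + e <= b by rewrite -lerBrDl ltW.
have [|||v1 c1] := He u a (a + e) => //.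
- by rewrite addrAC subrr add0r.
- move=> r; rewrite in_itv /= => /andP[ar rc]; apply: uw.
  by rewrite in_itv /= ar (lt_le_trans rc).
have [|||v2 c2] := IH (a + e) => //.
- move=> r; rewrite in_itv /= => /andP[ar rc]; apply: uw.
  by rewrite in_itv /= rc (le_lt_trans ac).
- by rewrite opprD addrA lerBlDr.
by eexists; exact: compensator_cat c1 c2.
Qed.

Lemma compensator_exists u t : admissible U t u -> exists v, compensator u 0 t v.
Proof.
move=> [_ [sub p H]].
suff K a : itv_partition a t sub -> (forall i, (i < size sub)%N ->
    {in `]nth 0 (a :: sub) i, nth 0 sub i[ &, forall s s', u s = u s'}) ->
    exists v, compensator u a t v by exact: K.
elim: sub a {p H} => [|x l IH] a [/= p /eqP lt] H.
  by rewrite -lt; exists (fun=> 1%g); exact: compensator_refl.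
move: p => /andP[ax pl].
have [v1 c1] : exists v, compensator u a x v.
  apply: (@compensator_cst _ _ _ (u ((a + x) / 2))); first exact: ltW.
  move=> r rax; apply: (H 0%N) => //=.
  by rewrite in_itv /= !(midf_lt ax).
have pl' : itv_partition x t l by split => //; apply/eqP.
have [i il|v2 c2] := IH x pl'; first exact: (H i.+1).
eexists; apply: compensator_cat c1 c2; first exact: ltW.
exact: itv_partition_le pl'.
Qed.

(** The product rule: gamma contributes P u, which right translation by k v
does not change, and v contributes dI (W u), which left translation by gamma k
does not change. *)
Lemma trajectory_compensated t u gamma v k : trajectory P t u gamma ->
  compensator u 0 t v -> trajectory A t u (fun r => gamma r * k * v r)%g.
Proof.
move=> [cg [S1 f1 dg]] [v0 cv _ [S2 f2 dv]]; split.
  apply: within_continuous_mulg cv; apply: within_continuous_mulg cg _.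
  exact: cst_continuous.
exists (S1 `|` S2); first by rewrite finite_setU.
move=> s st nS f sf.
have nS1 : ~ S1 s by move=> h; apply: nS; left.
have nS2 : ~ S2 s by move=> h; apply: nS; right.
have sf' := smooth_rmul (k * v s)%g sf.
have near_st : \forall q \near s, q \in `]0, t[ by exact: near_in_itvoo.
have near_cc : nbhs s `[0, t]%classic.
  by apply: filterS near_st => q; exact: subset_itv_oo_cc.
have near_S2 : \forall q \near s, ~ S2 q.
  apply: open_nbhs_nbhs; split => //; apply: closed_openC.
  have H := hausdorff_accessible (@order_hausdorff _ R).
  exact: (accessible_finite_set_closed.1 H).
have [us _] := dv s st nS2.
rewrite A_decomp // /vf_add.
have cgs := within_continuous_interior cg near_cc.
have cvs := within_continuous_interior cv near_cc.
have sW := vf_smooth (dI_vfield (W_inv (u s)).1) sf.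
apply: (@is_derive_diag R (fun p q => f (gamma p * k * v q)%g)
  (fun p => dI (W (u s)) f (gamma p.1 * k * v p.2)%g)).
- have := dg s st nS1 _ sf'; rewrite (_ : P _ _ _ = P (u s) f (gamma s * k * v s)%g).
    by congr (is_derive _ _ _ _); apply/funext => q; rewrite mulgA.
  by rewrite -mulgA -(P_inv (u s)).2.
- have H : \forall q \near s, compensates u v q /\ u q = u s.
    near=> q; split; last by near: q.
    by apply: dv; near: q.
  exists (setT, [set q | compensates u v q /\ u q = u s]).
    by split => //; exact: filterT.
  by move=> [p q] [_ /= [[_ dq] <-]]; exact: dq.
- have k1 := @for_continuous_fst _ _ _ _ _ s cgs.
  have k2 := @for_continuous_snd _ _ _ _ _ s cvs.
  have k0 : {for (s, s), continuous (fun _ : R * R => k)} by exact: cvg_cst.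
  have k3 := for_continuous_mulg (for_continuous_mulg k1 k0) k2.
  exact: (for_continuous_comp k3 (@smooth_fun_continuous _ _ _ _ sW _)).
Unshelve. all: by end_near. Qed.

(** Steer 1 to y, then follow the right translate by y of the path from 1 to x. *)
Lemma reachable_one_mul x y : Cen y -> reachable A U 1%g x ->
  reachable A U 1%g y -> reachable A U 1%g (x * y)%g.
Proof.
move=> cy /(reachable_rmul cy) rx ry; apply: reachable_trans ry _.
by rewrite mul1g in rx.
Qed.

(** For s close to r, both (v s)^-1 (v r) and its inverse are close to 1, hence
reachable from 1; by [reachable_one_mul], (v s)^-1 and (v r)^-1 are then
reachable or not together. *)
Lemma compensator_reachable u t v : (reachable A U 1%g)° (1%g : G) ->
  0 <= t -> compensator u 0 t v -> reachable A U 1%g (v t)^-1%g.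
Proof.
move=> N1 t0 [v0 /subspace_continuousP cv cen _].
apply: (@segment_chain R (fun r => reachable A U 1%g (v r)^-1%g) t); last first.
- by rewrite in_itv /= t0 lexx.
- move=> r rt.
  have H (w : G -> G) : continuous w -> w (v r) = 1%g ->
      \forall s \near r, s \in `[0, t] -> reachable A U 1%g (w (v s)).
    move=> cw w1; have /= := cvg_comp _ _ (cv r rt) (cw _).
    by rewrite {2}/from_subspace w1 => /(_ _ N1).
  have cst (x : G) y : {for y, continuous (fun _ : G => x)} by exact: cvg_cst.
  have H1 : \forall s \near r, s \in `[0, t] -> reachable A U 1%g ((v s)^-1 * v r)%g.
    apply: (H (fun x => x^-1 * v r)%g); last by rewrite mulVg.
    by move=> x; exact: (for_continuous_mulg (@invg_continuous _ _ _ x) (cst _ x)).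
  have H2 : \forall s \near r, s \in `[0, t] -> reachable A U 1%g ((v r)^-1 * v s)%g.
    apply: (H (fun x => (v r)^-1 * x)%g); last by rewrite mulVg.
    move=> x; apply: (for_continuous_mulg (cst _ x)); exact: cvg_id.
  apply: filterS2 H1 H2 => s h1 h2 st.
  have cr := centralizesV (cen r rt); have cs := centralizesV (cen s st).
  split => [Dr|Ds].
    by have := reachable_one_mul cr (h1 st) Dr; rewrite mulgK.
  by have := reachable_one_mul cs (h2 st) Ds; rewrite mulgK.
- by rewrite v0 invg1; exact: interior_subset.
Qed.

(** The route is g, then v t, then 1, then (v' t')^-1, then h, where v and v'
compensate trajectories of P from g to 1 and from 1 to h. *)
Lemma controllable_affine : controllable P U -> (reachable A U 1%g)° (1%g : G) ->
  controllable A U.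
Proof.
move=> cP N1 g; apply/seteqP; split => // h _.
have : reachable P U g 1%g by rewrite cP.
move=> [t /= t0 [u [gam [ua tg g0 g1]]]].
have [v cv] := compensator_exists ua.
(* The trajectory from g to 1, with k = 1. *)
have r1 : reachable A U g (v t).
  exists t => //; exists u, (fun r => gam r * 1 * v r)%g; split => //.
  - exact: trajectory_compensated tg cv.
  - by case: cv => -> _ _ _; rewrite !mulg1.
  - by rewrite g1 !mul1g.
have r2 : reachable A U (v t) 1%g.
  have := compensator_reachable N1 (ltW t0) cv.
  case: cv => _ _ cen _ /(@reachable_rmul (v t)); rewrite mul1g mulVg; apply.
  by apply: cen; rewrite in_itv /= lexx ltW.
have : reachable P U 1%g h by rewrite cP.
move=> [t' /= t'0 [u' [gam' [ua' tg' g'0 g'1]]]].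
have [v' cv'] := compensator_exists ua'.
have r3 := compensator_reachable N1 (ltW t'0) cv'.
have r4 : reachable A U (v' t')^-1%g h.
  exists t' => //; exists u', (fun r => gam' r * (v' t')^-1 * v' r)%g; split => //.
  - exact: trajectory_compensated tg' cv'.
  - by case: cv' => -> _ _ _; rewrite g'0 mul1g mulg1.
  - by rewrite g'1 mulgVK.
by apply: reachable_trans r1 _; apply: reachable_trans r2 _; exact: reachable_trans r3 r4.
Qed.

End AffineSystem.

(** * Combinations of invariant fields *)

Section LinearCombinations.
Context {R : realType} {n : nat} {G : lieGroupType R n}.
Implicit Types (X Z : vfield G).

Lemma right_invariant_comb (N : nat) (a : 'I_N -> R) (X : 'I_N -> vfield G) :
  (forall i, right_invariant (X i)) ->
  right_invariant (fun f x => \sum_(i < N) a i * X i f x).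
Proof.
move=> X_inv; split; first split.
- move=> f sf; apply: smooth_fun_sum => i; apply: smooth_funM; first exact: smooth_fun_cst.
  exact: vf_smooth (X_inv i).1 _ sf.
- move=> c f g sf sg x; rewrite mulr_sumr -big_split /=; apply: eq_bigr => i _.
  by rewrite (vf_linear (X_inv i).1) //; ring.
- move=> f g sf sg x; rewrite mulr_suml mulr_sumr -big_split /=; apply: eq_bigr => i _.
  by rewrite (vf_leibniz (X_inv i).1) //; ring.
by move=> h f sf x; apply: eq_bigr => i _; rewrite (X_inv i).2.
Qed.

Lemma right_invariant_add X Z : right_invariant X -> right_invariant Z ->
  right_invariant (vf_add X Z).
Proof.
move=> [hX rX] [hZ rZ]; split; first split.
- by move=> f sf; apply: smooth_funD; exact: vf_smooth.
- by move=> a f g sf sg x; rewrite /vf_add (vf_linear hX) // (vf_linear hZ) //; ring.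
- by move=> f g sf sg x; rewrite /vf_add (vf_leibniz hX) // (vf_leibniz hZ) //; ring.
by move=> h f sf x; rewrite /vf_add rX // rZ.
Qed.

Lemma vf_comb (X : vfield G) (N : nat) (a : 'I_N -> R) (f : 'I_N -> G -> R) x :
  is_vfield X -> (forall i, smooth_fun (f i)) ->
  X (fun y => \sum_(i < N) a i * f i y) x = \sum_(i < N) a i * X (f i) x.
Proof.
move=> hX sf; rewrite vf_sum //; last first.
  by move=> i; apply: smooth_funM; [exact: smooth_fun_cst|exact: sf].
apply: eq_bigr => i _.
have := vf_linear hX (a i) (sf i) (@smooth_fun_cst _ _ G 0) x.
rewrite vf_cst // addr0 => <-.
by congr (X _ x); apply/funext => y; rewrite addr0.
Qed.

Lemma bracket_comb0 (N : nat) (a b : 'I_N -> R) (X : 'I_N -> vfield G) :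
  (forall i, right_invariant (X i)) ->
  (forall i j, vf_eq (vf_bracket (X i) (X j)) (@vf0 R n G)) ->
  vf_eq (vf_bracket (fun f x => \sum_(i < N) a i * X i f x)
                    (fun f x => \sum_(i < N) b i * X i f x)) (@vf0 R n G).
Proof.
move=> X_inv X_comm f sf x; rewrite /vf_bracket /vf0.
have sX i : smooth_fun (X i f) by exact: vf_smooth (X_inv i).1 _ sf.
have E (c d : 'I_N -> R) : \sum_(i < N) c i * X i (fun y => \sum_(j < N) d j * X j f y) x =
    \sum_(i < N) \sum_(j < N) c i * d j * X i (X j f) x.
  apply: eq_bigr => i _; rewrite (vf_comb _ _ (X_inv i).1) // mulr_sumr.
  by apply: eq_bigr => j _; rewrite mulrA.
rewrite !E exchange_big /= -sumrB big1 // => i _; rewrite -sumrB big1 // => j _.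
have := X_comm j i f sf x; rewrite /vf_bracket /vf0 => /eqP; rewrite subr_eq0 => /eqP ->.
by rewrite [b i * _]mulrC subrr.
Qed.

(** The flow consists of automorphisms, which fix 1. *)
Lemma linear_field_one X f : linear_field X -> smooth_fun f -> X f 1%g = 0.
Proof.
move=> [_ [phi [[phi0 dphi] _ aut]]] sf.
have phi1 t : phi t 1%g = 1%g.
  by have [mphi _ _] := aut t; apply: (mulgI (phi t 1%g)); rewrite -mphi !mulg1.
have := dphi 1%g 0 f sf; rewrite phi0 => d1.
have E : (fun s => f (phi s 1%g)) = cst (f 1%g) by apply/funext => s; rewrite phi1.
rewrite E in d1; have d2 := is_derive_cst (f 1%g) (0 : R) (1 : R).
by rewrite -(@derive_val _ _ _ _ _ _ _ d1) (@derive_val _ _ _ _ _ _ _ d2).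
Qed.

End LinearCombinations.

(* [cX i] are the linear fields, [X i] the invariant ones; index [ord0] is the
   drift and [lift ord0 j] is the paper's index j. *)
Theorem corollary3p4 (R : realType) (n m : nat) (G : lieGroupType R n)
    (G_connected : connected [set: G])
    (cX X : 'I_m.+1 -> vfield G) (Y : vfield G) (Yc : 'I_m -> vfield G)
    (U : set 'rV[R]_m)
    (cX_linear : forall i, linear_field (cX i))
    (cX_comm : forall i j, vf_eq (vf_bracket (cX i) (cX j)) (@vf0 R n G))
    (cX_inner : forall i, inner_derivation (assoc_derivation (cX i)))
    (X_inv : forall i, right_invariant (X i))
    (cX_decomp : forall i, vf_eq (cX i) (vf_add (X i) (dI (X i))))
    (X_comm : forall i j, vf_eq (vf_bracket (X i) (X j)) (@vf0 R n G))
    (Y_inv : right_invariant Y)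
    (Yc_inv : forall j, right_invariant (Yc j)) :
  let Sigma_A : 'rV[R]_m -> vfield G :=
    control_affine (vf_add (cX ord0) Y)
      (fun j => vf_add (cX (lift ord0 j)) (Yc j)) in
  let Sigma_I : 'rV[R]_m -> vfield G :=
    control_affine (vf_add (X ord0) Y)
      (fun j => vf_add (X (lift ord0 j)) (Yc j)) in
  controllable Sigma_I U ->
  (exists2 t : R, 0 < t & (reachable_at Sigma_A U (1%g : G) t)° (1%g : G)) ->
  controllable Sigma_A U.
Proof.
move=> Sigma_A Sigma_I cI [t t0 At].
(* The drift is treated as a control of constant value 1. *)
pose coef (u : 'rV[R]_m) (i : 'I_m.+1) : R := oapp (u ord0) 1 (unlift ord0 i).
pose W (u : 'rV[R]_m) : vfield G := fun f x => \sum_(i < m.+1) coef u i * X i f x.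
have coefE u (F : 'I_m.+1 -> R) :
    \sum_(i < m.+1) coef u i * F i = F ord0 + \sum_(j < m) u ord0 j * F (lift ord0 j).
  rewrite big_ord_recl /coef unlift_none /= mul1r; congr (_ + _).
  by apply: eq_bigr => j _; rewrite liftK.
have W_inv u : right_invariant (W u) by exact: right_invariant_comb.
have I_inv u : right_invariant (Sigma_I u).
  apply: right_invariant_add; first exact: right_invariant_add.
  by apply: right_invariant_comb => j; exact: right_invariant_add.
apply: (@controllable_affine R n m G W Sigma_I Sigma_A U W_inv I_inv) => //.
- move=> u f sf x.
  have -> : vf_add (Sigma_I u) (dI (W u)) f x =
      Sigma_I u f x + \sum_(i < m.+1) coef u i * dI (X i) f x by [].
  rewrite coefE /Sigma_A /Sigma_I /control_affine /vf_add !cX_decomp //.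
  under eq_bigr do rewrite cX_decomp // /vf_add addrAC mulrDr.
  by rewrite big_split /= /vf_add; ring.
- by move=> u w; exact: bracket_comb0.
- move=> u f sf.
  have -> : dI (W u) f 1%g = \sum_(i < m.+1) coef u i * dI (X i) f 1%g by [].
  rewrite /W -sumrN; apply: eq_bigr => i _; rewrite -mulrN; congr (_ * _).
  have := linear_field_one (cX_linear i) sf; rewrite cX_decomp // /vf_add => /eqP.
  by rewrite addrC addr_eq0 => /eqP.
- apply: filterS At => g Ag; exists t => //.
Qed.
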